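(* Let $(A,d,\nu)$ be a dg-algebra over a field $k$, regarded as an $A_\infty$-algebra with $m_1=d$, $m_2=\nu$ and $m_n=0$ for $n\ge 3$. Then there exists a minimal model \[ i:(H_*(A),m)\rightarrow (A,d). \] Moreover, the $A_\infty$-structure on $H_*(A)$ is unique up to isomorphism of $A_\infty$-algebras.
   Context: Graded vector spaces are $\mathbb Z$-graded over a field $k$; tensor products of graded maps use the Koszul sign convention $(f\otimes g)(v\otimes w)=(-1)^{|g||v|}f(v)\otimes g(w)$. A dg-algebra $(A,d,\nu)$ is a graded associative unital algebra with product $\nu$ of degree $0$ and a linear map $d$ of degree $-1$ with $d^2=0$ and $d\nu=\nu(d\otimes \mathrm{id}+\mathrm{id}\otimes d)$. An $A_\infty$-algebra $(A,m)$ is a graded vector space $A$ with linear maps $m_n:A^{\otimes n}\to A$ of degree $n-2$, $n\ge1$, such that for all $n\ge1$: $\sum_{r+s+t=n,\ s\ge1,\ r,t\ge0}(-1)^{rs+t}m_{r+t+1}(\mathrm{id}^{\otimes r}\otimes m_s\otimes \mathrm{id}^{\otimes t})=0$. A morphism $f:(A,m)\to(A',m')$ of $A_\infty$-algebras is a family of linear maps $f_n:A^{\otimes n}\to A'$ of degree $n-1$, $n\ge 1$, such that for all $n\ge1$: $\sum_{r+s+t=n}(-1)^{rs+t}f_{r+t+1}(\mathrm{id}^{\otimes r}\otimes m_s\otimes\mathrm{id}^{\otimes t})=\sum_{i_1+\dots+i_r=n}(-1)^{l(i_1,\dots,i_r)}m'_r(f_{i_1}\otimes\dots\otimes f_{i_r})$,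 where $l(i_1,\dots,i_r)=\sum_{1\le j<k\le r}(i_k-1)i_j$. Composition is $(f'\circ f)_n=\sum_{i_1+\dots+i_r=n}(-1)^{l(i_1,\dots,i_r)}f'_r(f_{i_1}\otimes\dots\otimes f_{i_r})$, and the identity has first component $\mathrm{id}$ and all other components $0$; isomorphisms are meant in this category. A morphism $f$ is a quasi-isomorphism if $f_1$ induces an isomorphism on homology with respect to $m_1,m_1'$. For an $A_\infty$-algebra $(A,m)$, $H_*(A)$ is the homology of $(A,m_1)$, and the induced product on $H_*(A)$ is the map induced by $m_2$. A minimal model of $(A,m)$ is an $A_\infty$-structure $(H_*(A),m')$ with $m'_1=0$ and $m_2'$ the induced product, together with a quasi-isomorphism of $A_\infty$-algebras $i:(H_*(A),m')\to(A,m)$ such that $i_1$ induces the identity map on homology. *)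

(* Defs.v *)
From HB Require Import structures.
From mathcomp Require Import all_boot all_order all_algebra ring_quotient.
From mathcomp Require Import boolp zify.

Set Implicit Arguments.
Unset Strict Implicit.
Unset Printing Implicit Defensive.

Import GRing.Theory.
Local Open Scope ring_scope.

(* A Z-graded vector space is its total space together with the family of its
   homogeneous parts: [homog i x] says that [x] lies in the degree [i] part,
   and the total space is the internal direct sum of these parts. *)
Record gradedSpace (k : fieldType) := GradedSpace {
  gr_space :> lmodType k;
  homog : int -> gr_space -> Prop;
  homog0 : forall i, homog i 0;
  homogP : forall i (a : k) x y, homog i x -> homog i y -> homog i (a *: x + y);
  homog_span : forall x, exists (s : seq int) (c : int -> gr_space),
    [/\ uniq s, forall i, homog i (c i) & x = \sum_(i <- s) c i];
  homog_free : forall (s : seq int) (c : int -> gr_space),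
    uniq s -> (forall i, homog i (c i)) -> \sum_(i <- s) c i = 0 ->
    forall i, i \in s -> c i = 0 }.

Section GradedTheory.
Variables (k : fieldType) (V : gradedSpace k).

Lemma homogB i (x y : V) : homog i x -> homog i y -> homog i (x - y).
Proof. by move=> hx hy; rewrite addrC -scaleN1r; apply: homogP. Qed.

Lemma homog_dec (x : V) : exists (s : seq int) (c : int -> V),
  [/\ uniq s, forall i, homog i (c i), forall i, i \notin s -> c i = 0
    & x = \sum_(i <- s) c i].
Proof.
have [s [c [us hc ->]]] := homog_span x.
exists s, (fun i => if i \in s then c i else 0); split=> //.
- by move=> i; case: ifP => // _; exact: homog0.
- by move=> i /negbTE->.
- by apply: eq_big_seq => i ->.
Qed.

End GradedTheory.

(* The differential has degree -1. *)
Record chainComplex (k : fieldType) := ChainComplex {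
  cx_space :> gradedSpace k;
  cx_d : cx_space -> cx_space;
  cx_d_linear : linear cx_d;
  cx_d_degree : forall i x, homog i x -> homog (i - 1) (cx_d x);
  cx_d_square : forall x, cx_d (cx_d x) = 0 }.

Section Homology.
Variables (k : fieldType) (C : chainComplex k).
Local Notation d := (@cx_d k C).

HB.instance Definition _ := GRing.isLinear.Build k C C _ d (@cx_d_linear k C).

Definition is_cycle : pred C := fun x => d x == 0.

Fact is_cycle_submod : submod_closed is_cycle.
Proof.
split=> [|a x y]; first by apply/eqP; rewrite linear0.
move=> /eqP dx0 /eqP dy0; apply/eqP.
by rewrite linearP /= dx0 dy0 scaler0 addr0.
Qed.
HB.instance Definition _ := GRing.isSubmodClosed.Build k C is_cycle is_cycle_submod.

Record cycle := Cycle { cycle_val :> C; cycle_valP : is_cycle cycle_val }.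
HB.instance Definition _ := [isSub for cycle_val].
HB.instance Definition _ := [Choice of cycle by <:].
HB.instance Definition _ := [SubChoice_isSubLmodule of cycle by <:].

Lemma cycle_valE (T : Type) (s : seq T) (z : T -> cycle) :
  cycle_val (\sum_(i <- s) z i) = \sum_(i <- s) cycle_val (z i).
Proof. exact: (raddf_sum (val : cycle -> C)). Qed.

Definition is_boundary : pred cycle := fun z => `[< exists y, d y = cycle_val z >].

Fact is_boundary_zmod : zmod_closed is_boundary.
Proof.
split=> [|x y]; rewrite !unfold_in.
  by apply/asboolP; exists 0; rewrite linear0.
move=> /asboolP[u eu] /asboolP[v ev]; apply/asboolP; exists (u - v).
by rewrite linearB /= eu ev.
Qed.
HB.instance Definition _ := GRing.isZmodClosed.Build cycle is_boundary is_boundary_zmod.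

Definition boundaries : zmodClosed cycle :=
  GRing.ZmodClosed.clone cycle is_boundary _.

Definition hquot : Type := Quotient.quot boundaries.
HB.instance Definition _ := GRing.Zmodule.on hquot.

Definition hclass : cycle -> hquot := @generic_quotient.pi _ (Quotient.quot boundaries).

Lemma hclass_surj q : exists z, hclass z = q.
Proof. by exists (generic_quotient.repr (q : Quotient.quot boundaries)); exact: generic_quotient.reprK. Qed.

Lemma hclass_eq (x y : cycle) :
  hclass x = hclass y <-> exists u, d u = cycle_val x - cycle_val y.
Proof.
split=> [/eqP|h].
  by rewrite /hclass -Quotient.idealrBE => /asboolP.
by apply/eqP; rewrite /hclass -Quotient.idealrBE; apply/asboolP.
Qed.

Lemma hclassD : {morph hclass : x y / x + y}.
Proof. by move=> x y; rewrite /hclass !raddfD. Qed.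

Definition hrepr (q : hquot) : cycle :=
  generic_quotient.repr (q : Quotient.quot boundaries).

Lemma hreprK : cancel hrepr hclass.
Proof. by move=> q; exact: generic_quotient.reprK. Qed.

Definition hscale (a : k) (q : hquot) : hquot := hclass (a *: hrepr q).

Lemma hscaleE a z : hscale a (hclass z) = hclass (a *: z).
Proof.
have /hclass_eq[u eu] := hreprK (hclass z).
by apply/hclass_eq; exists (a *: u); rewrite linearZ /= eu scalerBr.
Qed.

Fact hscaleA a b q : hscale a (hscale b q) = hscale (a * b) q.
Proof. by rewrite {2}/hscale hscaleE scalerA. Qed.
Fact hscale1 : left_id 1 hscale.
Proof. by move=> q; rewrite /hscale scale1r hreprK. Qed.
Fact hscaleDr : right_distributive hscale +%R.
Proof.
move=> a p q; rewrite -[p]hreprK -[q]hreprK -hclassD !hscaleE.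
by rewrite scalerDr hclassD.
Qed.
Fact hscaleDl q : {morph hscale^~ q : a b / a + b}.
Proof. by move=> a b; rewrite /hscale scalerDl hclassD. Qed.
HB.instance Definition _ :=
  GRing.Zmodule_isLmodule.Build k hquot hscaleA hscale1 hscaleDr hscaleDl.

Fact hclass_linear : linear hclass.
Proof. by move=> a x y; rewrite hclassD -hscaleE. Qed.
HB.instance Definition _ := GRing.isLinear.Build k cycle hquot _ hclass hclass_linear.

Definition hhomog (i : int) (q : hquot) : Prop :=
  exists2 z : cycle, homog i (cycle_val z) & hclass z = q.

Lemma cycle_dec (z : cycle) : exists (s : seq int) (c : int -> cycle),
  [/\ uniq s, forall i, homog i (cycle_val (c i)) & z = \sum_(i <- s) c i].
Proof.
have [s [c [us hc c0 e]]] := homog_dec (cycle_val z).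
have hdc i : is_cycle (c i).
  have [iNs|/c0 ->] := boolP (i \in s); last by rewrite /is_cycle linear0.
  have us' : uniq [seq j - 1 | j <- s].
    by rewrite map_inj_uniq // => x y /(addIr _).
  have := @homog_free _ C [seq j - 1 | j <- s] (fun j => d (c (j + 1))) us' _ _ (i - 1).
  rewrite subrK => h; apply/eqP; apply: h.
  - by move=> j; have := cx_d_degree (hc (j + 1)); rewrite addrK.
  - rewrite big_map; under eq_bigr do rewrite subrK.
    by rewrite -linear_sum -e; apply/eqP; exact: cycle_valP.
  - exact: (map_f (fun j => j - 1)).
exists s, (fun i => Cycle (hdc i)); split=> //.
by apply: val_inj; rewrite /= cycle_valE.
Qed.

Fact hhomog0 i : hhomog i 0.
Proof. by exists 0; [exact: homog0 | exact: linear0]. Qed.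
Fact hhomogP i (a : k) x y : hhomog i x -> hhomog i y -> hhomog i (a *: x + y).
Proof.
move=> [u hu <-] [v hv <-]; exists (a *: u + v); last by rewrite linearP.
exact: homogP.
Qed.
Fact hhomog_span x : exists (s : seq int) (c : int -> hquot),
  [/\ uniq s, forall i, hhomog i (c i) & x = \sum_(i <- s) c i].
Proof.
have [s [c [us hc e]]] := cycle_dec (hrepr x).
exists s, (hclass \o c); split=> // [i|]; first by exists (c i).
by rewrite -[LHS]hreprK e linear_sum.
Qed.
Fact hhomog_free (s : seq int) (c : int -> hquot) :
  uniq s -> (forall i, hhomog i (c i)) -> \sum_(i <- s) c i = 0 ->
  forall i, i \in s -> c i = 0.
Proof.
move=> us hc sc0 i si.
have [|z hz] := @boolp.choice _ _
    (fun j w => homog j (cycle_val w) /\ hclass w = c j).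
  by move=> j; have [w] := hc j; exists w.
have : hclass (\sum_(i <- s) z i) = hclass 0.
  by rewrite linear0 linear_sum -[RHS]sc0; apply: eq_bigr => j _; case: (hz j).
move=> /hclass_eq[y]; rewrite subr0.
have [t [b [ut hb b0 ->]]] := homog_dec y.
rewrite linear_sum cycle_valE /= => e.
pose u := undup (s ++ [seq j - 1 | j <- t]).
pose g j := d (b (j + 1)) - (if j \in s then cycle_val (z j) else 0).
have gi0 : g i = 0.
apply: (@homog_free _ C u g (undup_uniq _)).
- move=> j; apply: homogB; last first.
    by case: ifP => _; [case: (hz j) | exact: homog0].
  by have := cx_d_degree (hb (j + 1)); rewrite addrK.
- have sub (w : seq int) (F : int -> C) : uniq w -> {subset w <= u} ->
      (forall j, j \notin w -> F j = 0) -> \sum_(j <- u) F j = \sum_(j <- w) F j.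
    move=> uw wu F0; rewrite (bigID (fun j => j \in w)) /= [X in _ + X]big1 ?addr0.
      rewrite -big_filter; apply: perm_big; apply: uniq_perm => //.
        exact/filter_uniq/undup_uniq.
      move=> j; rewrite mem_filter; case: (boolP (j \in w)) => // /wu.
      by [].
    by move=> j /F0.
  rewrite sumrB (sub [seq j - 1 | j <- t]); first 1 last.
  + by rewrite map_inj_uniq // => x x' /(addIr _).
  + by move=> j jt; rewrite mem_undup mem_cat jt orbT.
  + move=> j jt; rewrite b0 ?linear0 //; apply: contra jt => jt.
    by apply/mapP; exists (j + 1); rewrite ?addrK.
  rewrite (sub s) //; first 1 last.
  + by move=> j js; rewrite mem_undup mem_cat js.
  + by move=> j /negbTE->.
  rewrite big_map; under eq_bigr do rewrite subrK.
  rewrite e; apply/eqP; rewrite subr_eq0; apply/eqP.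
  by apply: eq_big_seq => j ->.
- by rewrite mem_undup mem_cat si.
move/eqP: gi0; rewrite /g si subr_eq0 => /eqP ei.
have [_ <-] := hz i; rewrite -(linear0 hclass); apply/hclass_eq.
by exists (b (i + 1)); rewrite subr0.
Qed.

Definition homology : gradedSpace k :=
  @GradedSpace k hquot hhomog hhomog0 hhomogP hhomog_span hhomog_free.

End Homology.

Section InducedMap.
Variables (k : fieldType) (C D : chainComplex k) (f : C -> D).

Definition is_chain_map : Prop :=
  [/\ linear f, forall i x, homog i x -> homog i (f x)
    & forall x, f (cx_d x) = cx_d (f x)].

Hypothesis hf : is_chain_map.

Fact chain_map_cycle (z : cycle C) : is_cycle (f (cycle_val z)).
Proof.
have [fl _ fd] := hf; apply/eqP; rewrite -fd (eqP (cycle_valP z)).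
by have := fl (-1) 0 0; rewrite scaleN1r addNr scaleN1r addNr.
Qed.

Definition cycle_map (z : cycle C) : cycle D := Cycle (chain_map_cycle z).

Definition homology_map (q : homology C) : homology D :=
  hclass (cycle_map (hrepr q)).

Lemma homology_mapE z : homology_map (hclass z) = hclass (cycle_map z).
Proof.
have [fl _ fd] := hf.
have /hclass_eq[u eu] := hreprK (hclass z).
apply/hclass_eq; exists (f u); rewrite -fd eu /=.
have -> : cycle_val (hrepr (hclass z)) - cycle_val z
        = (-1) *: cycle_val z + cycle_val (hrepr (hclass z)).
  by rewrite scaleN1r addrC.
by rewrite fl scaleN1r addrC.
Qed.

End InducedMap.

Section Families.
Variables (k : fieldType).
Implicit Types V W X : gradedSpace k.

(* A family of maps f_n : V^{(x) n} -> W, n >= 1, is encoded by one function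
   f : seq V -> W, whose restriction to sequences of length n is f_n, seen as an
   n-linear map.  The value at the empty sequence is irrelevant and is ignored
   throughout.  Since Koszul signs involve degrees, identities between such
   families are stated on sequences of homogeneous elements, each given with a
   degree; by multilinearity this determines the maps. *)
Definition homog_seq V (xs : seq (int * V)) : Prop :=
  forall p, p \in xs -> homog p.1 p.2.

Definition degs V (xs : seq (int * V)) : int := \sum_(p <- xs) p.1.

Definition elts V (xs : seq (int * V)) : seq V := [seq p.2 | p <- xs].

Definition multilinear V W (f : seq V -> W) : Prop :=
  forall s t : seq V, linear (fun x => f (s ++ x :: t)).

(* f_n has degree e n *)
Definition family_degree V W (e : nat -> int) (f : seq V -> W) : Prop :=
  forall xs, homog_seq xs -> (0 < size xs)%N ->
    homog (degs xs + e (size xs)) (f (elts xs)).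

(* f_{r+t+1} (id^{(x) r} (x) m_s (x) id^{(x) t}), evaluated at xs *)
Definition insert_at V W (f : seq V -> W) (m : seq V -> V) (r s : nat)
    (xs : seq (int * V)) : W :=
  (-1 : k) ^ ((s%:Z - 2) * degs (take r xs)) *:
  f (elts (take r xs) ++ m (elts (take s (drop r xs))) :: elts (drop (r + s) xs)).

(* The sum over r + s + t = n with s >= 1, for n = size xs. *)
Definition insert_sum V W (f : seq V -> W) (m : seq V -> V)
    (xs : seq (int * V)) : W :=
  \sum_(0 <= r < size xs) \sum_(1 <= s < (size xs - r).+1)
    (-1 : k) ^+ (r * s + (size xs - r - s)) *: insert_at f m r s xs.

Definition is_composition (n : nat) (c : seq nat) : bool :=
  all (leq 1) c && (sumn c == n).

Definition comp_exponent (c : seq nat) : nat :=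
  (\sum_(q < size c) \sum_(p < q) (nth 0 c q - 1) * nth 0 c p)%N.

(* g_r (f_{i_1} (x) ... (x) f_{i_r}) evaluated at xs, for (i_1, ..., i_r) = c
   and f_i of degree i - 1: moving f_{i_q} past the p-th block of xs, p < q,
   contributes the sign (-1)^{(i_q - 1) |p-th block|}. *)
Definition blockwise V W X (g : seq W -> X) (f : seq V -> W) (c : seq nat)
    (xs : seq (int * V)) : X :=
  (-1 : k) ^ (\sum_(q < size c) \sum_(p < q)
                ((nth 0%N c q)%:Z - 1) * degs (nth [::] (reshape c xs) p)) *:
  g [seq f (elts b) | b <- reshape c xs].

(* The sum over r and i_1 + ... + i_r = n with all i_j >= 1, for n = size xs. *)
Definition blockwise_sum V W X (g : seq W -> X) (f : seq V -> W)
    (xs : seq (int * V)) : X :=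
  \sum_(1 <= r < (size xs).+1)
    \sum_(c : r.-tuple 'I_(size xs).+1 | is_composition (size xs) (map val c))
      (-1 : k) ^+ comp_exponent (map val c) *: blockwise g f (map val c) xs.

Definition same_family V W (f g : seq (int * V) -> W) : Prop :=
  forall xs, homog_seq xs -> (0 < size xs)%N -> f xs = g xs.

Record ainfStructure V := AinfStructure {
  ainf_op :> seq V -> V;
  ainf_multilinear : multilinear ainf_op;
  ainf_degree : family_degree (fun n => n%:Z - 2) ainf_op;
  ainf_stasheff : same_family (insert_sum ainf_op ainf_op) (fun=> 0) }.

Record ainfMorphism V W (m : ainfStructure V) (m' : ainfStructure W) :=
  AinfMorphism {
    amor :> seq V -> W;
    amor_multilinear : multilinear amor;
    amor_degree : family_degree (fun n => n%:Z - 1) amor;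
    amor_eq : same_family (insert_sum amor m) (blockwise_sum m' amor) }.

Definition ainf_comp V W X (g : seq W -> X) (f : seq V -> W)
  : seq (int * V) -> X := blockwise_sum g f.

Definition ainf_id V (xs : seq (int * V)) : V :=
  if xs is [:: p] then p.2 else 0.

Definition ainf_isomorphic V W (m : ainfStructure V) (m' : ainfStructure W) :=
  exists (f : ainfMorphism m m') (g : ainfMorphism m' m),
    same_family (ainf_comp g f) (@ainf_id V) /\
    same_family (ainf_comp f g) (@ainf_id W).

End Families.

Section AinfHomology.
Variables (k : fieldType) (V : gradedSpace k) (m : ainfStructure V).

Lemma homog_ext (W : lmodType k) (f : V -> W) :
  linear f -> (forall i x, homog i x -> f x = 0) -> forall x, f x = 0.
Proof.
move=> fl f0 x; have [s [c [_ hc ->]]] := homog_span x.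
pose F := GRing.isLinear.Build k V W _ f fl.
pose g : {linear V -> W} := HB.pack f F.
rewrite -[f]/(g : V -> W) linear_sum big1 // => i _; exact: f0 (hc i).
Qed.

Definition ainf_d (x : V) : V := m [:: x].

Fact ainf_d_linear : linear ainf_d.
Proof. exact: (@ainf_multilinear _ _ m [::] [::]). Qed.

Fact ainf_d_degree i x : homog i x -> homog (i - 1) (ainf_d x).
Proof.
move=> hx; have := @ainf_degree _ _ m [:: (i, x)].
rewrite /degs big_seq1 /=; apply => // p.
by rewrite inE => /eqP->.
Qed.

Fact ainf_d_square x : ainf_d (ainf_d x) = 0.
Proof.
apply: (@homog_ext _ (ainf_d \o ainf_d)) => [a u v|i y hy] /=.
  by rewrite !ainf_d_linear.
have := @ainf_stasheff _ _ m [:: (i, y)].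
rewrite /insert_sum /= big_nat1 big_nat1 /insert_at /= /degs big_nil mulr0.
rewrite expr0z !scale1r; apply=> // p.
by rewrite inE => /eqP->.
Qed.

Definition ainf_complex : chainComplex k :=
  ChainComplex ainf_d_linear ainf_d_degree ainf_d_square.

Lemma ainf_leibniz i j x y : homog i x -> homog j y ->
  ainf_d (m [:: x; y]) =
  m [:: ainf_d x; y] + (-1 : k) ^ (- i) *: m [:: x; ainf_d y].
Proof.
move=> hx hy; have := @ainf_stasheff _ _ m [:: (i, x); (j, y)].
rewrite /insert_sum /index_iota /= !big_cons !big_nil /insert_at /= /degs.
rewrite !big_cons !big_nil /= !mulr0 !addr0 !expr0z !scale1r expr1 !scaleN1r.
have -> : (1%Z - 2) * i = - i by rewrite mulN1r.
move=> e; apply/eqP; rewrite -subr_eq0; apply/eqP.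
rewrite -[RHS]e //; first by rewrite opprD addrA [- _ + _ in RHS]addrC.
by move=> p; rewrite !inE => /orP[] /eqP->.
Qed.

Lemma ainf_mul_sumr (I : Type) (r : seq I) x (F : I -> V) :
  m [:: x; \sum_(i <- r) F i] = \sum_(i <- r) m [:: x; F i].
Proof.
pose f y := m [:: x; y].
have fl : linear f := @ainf_multilinear _ _ m [:: x] [::].
pose g : {linear V -> V} := HB.pack f (GRing.isLinear.Build k V V _ f fl).
exact: (linear_sum g).
Qed.

Lemma ainf_mul_suml (I : Type) (r : seq I) y (F : I -> V) :
  m [:: \sum_(i <- r) F i; y] = \sum_(i <- r) m [:: F i; y].
Proof.
pose f x := m [:: x; y].
have fl : linear f := @ainf_multilinear _ _ m [::] [:: y].
pose g : {linear V -> V} := HB.pack f (GRing.isLinear.Build k V V _ f fl).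
exact: (linear_sum g).
Qed.

Local Notation cycle := (cycle ainf_complex).

Lemma cycle_d (z : cycle) : ainf_d (cycle_val z) = 0.
Proof. exact/eqP/(cycle_valP z). Qed.

Lemma ainf_mul0r x : m [:: x; 0] = 0.
Proof. by have := @ainf_mul_sumr bool [::] x (fun=> 0); rewrite !big_nil. Qed.

Lemma ainf_mul0l x : m [:: 0; x] = 0.
Proof. by have := @ainf_mul_suml bool [::] x (fun=> 0); rewrite !big_nil. Qed.

Lemma ainf_d_sum (I : Type) (r : seq I) (F : I -> V) :
  ainf_d (\sum_(i <- r) F i) = \sum_(i <- r) ainf_d (F i).
Proof. exact: (linear_sum (@cx_d k ainf_complex : {linear _ -> _})). Qed.

Lemma ainf_dZ (a : k) x : ainf_d (a *: x) = a *: ainf_d x.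
Proof. exact: (linearZ_LR (@cx_d k ainf_complex : {linear _ -> _})). Qed.

Lemma ainf_d_mul_cycle u (b : cycle) :
  ainf_d (m [:: u; cycle_val b]) = m [:: ainf_d u; cycle_val b].
Proof.
have [s [c [_ hc ->]]] := homog_span u.
have [t [e [_ he ->]]] := cycle_dec b.
rewrite cycle_valE ainf_mul_suml !ainf_d_sum ainf_mul_suml.
apply: eq_bigr => i _; rewrite !ainf_mul_sumr ainf_d_sum.
apply: eq_bigr => j _; rewrite (ainf_leibniz (hc i) (he j)) cycle_d.
by rewrite ainf_mul0r scaler0 addr0.
Qed.

Fact ainf_mul_cycleP (a b : cycle) :
  @is_cycle k ainf_complex (m [:: cycle_val a; cycle_val b]).
Proof.
by apply/eqP; rewrite [LHS]ainf_d_mul_cycle cycle_d ainf_mul0l.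
Qed.

Definition ainf_mul_cycle (a b : cycle) : cycle := Cycle (ainf_mul_cycleP a b).

(* The product induced by m_2 on homology; see [induced_mulE]. *)
Definition induced_mul (p q : homology ainf_complex) : homology ainf_complex :=
  hclass (ainf_mul_cycle (hrepr p) (hrepr q)).

Lemma induced_mulE a b :
  induced_mul (hclass a) (hclass b) = hclass (ainf_mul_cycle a b).
Proof.
rewrite /induced_mul; set a' := hrepr _; set b' := hrepr _.
have /hclass_eq[u eu] : hclass a' = hclass a by exact: hreprK.
have /hclass_eq[v ev] : hclass b' = hclass b by exact: hreprK.
have step1 : hclass (ainf_mul_cycle a' b') = hclass (ainf_mul_cycle a b').
  apply/hclass_eq; exists (m [:: u; cycle_val b'] : ainf_complex).
  rewrite [LHS]ainf_d_mul_cycle [ainf_d u]eu /=.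
  have := @ainf_multilinear _ _ m [::] [:: cycle_val b'] (-1) (cycle_val a).
  move/(_ (cycle_val a')); rewrite /= !scaleN1r => h.
  by rewrite [X in m [:: X; _]]addrC h addrC.
rewrite step1; apply/hclass_eq.
have [s [c [_ hc ea]]] := cycle_dec a.
exists (\sum_(i <- s) (-1 : k) ^ i *: m [:: cycle_val (c i); v] : ainf_complex).
rewrite [LHS]ainf_d_sum.
transitivity (m [:: cycle_val a; ainf_d v]).
  rewrite ea cycle_valE ainf_mul_suml; apply: eq_bigr => i _.
  rewrite ainf_dZ; have [t [w [_ hw ->]]] := homog_span v.
  rewrite ainf_mul_sumr !ainf_d_sum ainf_mul_sumr scaler_sumr.
  apply: eq_bigr => j _; rewrite (ainf_leibniz (hc i) (hw j)) cycle_d.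
  rewrite ainf_mul0l add0r scalerA -expfzDr ?oppr_eq0 ?oner_eq0 //.
  by rewrite subrr expr0z scale1r.
rewrite [ainf_d v]ev /=.
have := @ainf_multilinear _ _ m [:: cycle_val a] [::] (-1) (cycle_val b).
move/(_ (cycle_val b')); rewrite /= !scaleN1r => h.
by rewrite [X in m [:: _; X]]addrC h addrC.
Qed.

End AinfHomology.

Record dgAlgebra (k : fieldType) := DgAlgebra {
  dga_complex :> chainComplex k;
  dga_mul : dga_complex -> dga_complex -> dga_complex;
  dga_one : dga_complex;
  dga_mul_linearl : forall y, linear (fun x => dga_mul x y);
  dga_mul_linearr : forall x, linear (dga_mul x);
  dga_mulA : associative dga_mul;
  dga_mul1x : left_id dga_one dga_mul;
  dga_mulx1 : right_id dga_one dga_mul;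
  dga_one_degree : homog 0 dga_one;
  dga_mul_degree : forall i j x y,
    homog i x -> homog j y -> homog (i + j) (dga_mul x y);
  (* the sign is the Koszul sign (-1)^{|d| |x|} of (id (x) d)(x (x) y) *)
  dga_leibniz : forall i x y, homog i x ->
    cx_d (dga_mul x y) = dga_mul (cx_d x) y + (-1 : k) ^ (- i) *: dga_mul x (cx_d y) }.

Section DgaAinf.
Variables (k : fieldType) (A : dgAlgebra k).
Local Notation mul := (@dga_mul k A).

Definition dga_op (xs : seq A) : A :=
  match xs with
  | [:: x] => cx_d x
  | [:: x; y] => mul x y
  | _ => 0
  end.

Fact dga_op_multilinear : multilinear dga_op.
Proof.
have z (b : k) : 0 = b *: 0 + 0 :> A by rewrite scaler0 addr0.
case=> [|x [|x' s]].
- case=> [|y [|y' t]] a u v /=; [exact: cx_d_linear | exact: dga_mul_linearl |].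
  exact: z.
- by case=> [|y t] a u v /=; [exact: dga_mul_linearr | exact: z].
- by move=> t a u v; case: s => [|w s]; exact: z.
Qed.

Fact dga_op_degree : family_degree (fun n => n%:Z - 2) dga_op.
Proof.
case=> [|[i x] [|[j y] [|p xs]]] //= h _;
  rewrite /degs !big_cons ?big_nil /=.
- have -> : i + 0 + (1%:Z - 2) = i - 1 by rewrite addr0.
  by apply: cx_d_degree; apply: (h (i, x)); rewrite inE.
- have -> : i + (j + 0) + (2%:Z - 2) = i + j by rewrite subrr !addr0.
  by apply: dga_mul_degree; [apply: (h (i, x)) | apply: (h (j, y))];
    rewrite !inE eqxx ?orbT.
- exact: homog0.
Qed.

Lemma dga_op_size (xs : seq A) : (2 < size xs)%N -> dga_op xs = 0.
Proof. by case: xs => [|x [|y [|z xs]]]. Qed.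

Fact dga_mul0x x : mul 0 x = 0.
Proof.
have := @dga_mul_linearl _ A x (-1) 0 0.
by rewrite !scaleN1r oppr0 addr0 addNr.
Qed.

Fact dga_mulx0 x : mul x 0 = 0.
Proof.
have := @dga_mul_linearr _ A x (-1) 0 0.
by rewrite !scaleN1r oppr0 addr0 addNr.
Qed.

Fact dga_op_zero s t : dga_op (s ++ 0 :: t) = 0.
Proof.
have := dga_op_multilinear s t (-1) 0 0.
by rewrite !scaleN1r oppr0 addr0 addNr.
Qed.

Fact dga_stasheff : same_family (insert_sum dga_op dga_op) (fun=> 0).
Proof.
move=> xs hxs; case: (ltnP 3 (size xs)) => [n4 _|].
  rewrite /insert_sum big_nat big1 // => r /andP[_ rn].
  rewrite big_nat big1 // => s /andP[s1 sn]; rewrite /insert_at.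
  have [s3|s2] := ltnP 2 s.
    rewrite (dga_op_size (xs := elts (take s _))) ?dga_op_zero ?scaler0 //.
    by rewrite size_map size_takel // size_drop.
  rewrite dga_op_size ?scaler0 //.
  rewrite size_cat /= !size_map size_drop size_takel ?(ltnW rn) //.
  lia.
case: xs hxs => [|[i x] [|[j y] [|[l z] [|p xs]]]] //= h _ _;
rewrite /insert_sum /index_iota /= !big_cons !big_nil /insert_at /= /degs
  ?big_cons ?big_nil /= ?(mulr0, addr0, expr0z, expr0, expr1, scale1r, scaler0).
- exact: cx_d_square.
- rewrite !scaleN1r (dga_leibniz _ (i := i)); last first.
    by apply: (h (i, x)); rewrite inE eqxx.
  have -> : (1%Z - 2) * i = - i by rewrite mulN1r.
  by rewrite addrA addNr add0r subrr.
- rewrite add0r -[cx_d 0]/(dga_op ([::] ++ 0 :: [::])) dga_op_zero addr0.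
  have -> : (2%Z - 2) * i = 0 by rewrite subrr mul0r.
  by rewrite add0r expr0z expr2 mulrNN mulr1 !scale1r scaleN1r dga_mulA addNr.
Qed.

Definition dga_ainf : ainfStructure A :=
  AinfStructure dga_op_multilinear dga_op_degree dga_stasheff.

End DgaAinf.

Section AinfFirstComponent.
Variables (k : fieldType) (V W : gradedSpace k).
Variables (m : ainfStructure V) (m' : ainfStructure W).
Variable f : ainfMorphism m m'.

Definition amor1 (x : ainf_complex m) : ainf_complex m' := f [:: x].

Fact amor1_chain_map : is_chain_map amor1.
Proof.
split=> [|i x hx|].
- exact: (@amor_multilinear _ _ _ _ _ f [::] [::]).
- have := @amor_degree _ _ _ _ _ f [:: (i, x)].
  rewrite /degs big_seq1 /= subrr addr0; apply=> // p.
  by rewrite inE => /eqP->.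
pose F x : W := f (m [:: x] :: [::]) - m' [:: f [:: x]].
suff F0 : forall x, F x = 0.
  by move=> x; apply/eqP; rewrite -subr_eq0; apply/eqP/(F0 x).
have fl := @amor_multilinear _ _ _ _ _ f [::] [::].
apply: homog_ext => [a u v|i x hx]; rewrite /F.
  rewrite [m [:: _]](@ainf_multilinear _ _ m [::] [::]) [f [:: _]]fl.
  rewrite [f [:: a *: u + v]]fl [m' [:: _]](@ainf_multilinear _ _ m' [::] [::]).
  by rewrite /= scalerBr opprD addrACA.
have := @amor_eq _ _ _ _ _ f [:: (i, x)].
rewrite /insert_sum /blockwise_sum /= !big_nat1.
rewrite (big_pred1 [tuple (ord_max : 'I_2)]); last first.
  case=> [[|c [|c' cs]] // hs]; apply/idP/eqP => [h|->] //.
  apply: val_inj; congr [:: _]; apply: val_inj => /=.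
  by move: h; rewrite /is_composition /= addn0 => /andP[_ /eqP].
rewrite /insert_at /blockwise /comp_exponent /= /degs !big_nil mulr0.
rewrite !big_ord_recl !big_ord0 /= !addr0 !expr0z !expr0 !scale1r => -> //.
  by rewrite subrr.
by move=> p; rewrite inE => /eqP->.
Qed.

(* A bijective linear map of degree 0 is an isomorphism of graded spaces. *)
Definition quasi_isomorphism : Prop :=
  bijective (homology_map amor1_chain_map).

End AinfFirstComponent.

(* As m'_1 = 0, every element of H_*(A) is a cycle for m'_1; the last clause
   says that H_*(i_1) sends its class back to the element itself. *)
Definition is_minimal_model (k : fieldType) (V : gradedSpace k)
    (m : ainfStructure V) (m' : ainfStructure (homology (ainf_complex m)))
    (i : ainfMorphism m' m) : Prop :=
  [/\ forall p, m' [:: p] = 0,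
      forall p q, m' [:: p; q] = induced_mul p q,
      quasi_isomorphism i
    & forall z : cycle (ainf_complex m'),
        homology_map (amor1_chain_map i) (hclass z) = cycle_val z].

(* Main.v *)
(* Reading a family f_n on the suspension of V absorbs every Koszul sign: the
   A_infinity relations become identities between functions on words, where an
   operation b acts by inserting b on a factor (and the parity involution tau on
   the letters to its left), and a morphism f by cutting a word into blocks.
   For functions with values in the dg-algebra A there is moreover the
   convolution product along cuts of a word in two.

   Existence.  A contraction (i, p, h) of A onto H(A) determines F by
   F_1 = i and F_n = h (F * F)_n, and b = p (F * F).  The curvature K of F
   satisfies K = - h (K * F - F * K), so it vanishes by induction on word length.

   Uniqueness.  A morphism into A is a twisting function.  Given minimal models
   al, al', one builds simultaneously f : m -> m' and a gauge transformation g,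
   with g = 1 on the empty word, from al to al' o f.  By the Bianchi identity,
   the differential of the n-th obstruction to g is al'_1 of the n-th obstruction
   to f being a morphism; the latter is a homology class that is a boundary,
   so it vanishes, and then f_n and g_n can be chosen.  As f_1 = id, f is
   invertible. *)

(* Both recursions are given by closed formulas in [p] and [h]: the value on a word is prescribed
   from the values on shorter words before anything is known about cycles or boundaries.
   Multilinearity and degrees travel with the recursion, and the equations are proved afterwards by
   induction on length, so no graded multilinear lift is ever chosen along the way. The only choices
   lie in the contraction; there is no finiteness assumption, so it comes from Zorn's lemma, in the
   form of an [h] with [d h d = d]. The components of [f] and [g] must be found together. At length
   n the gauge equation reads [E + d g_n + al'_1 f_n = 0], up to [tau], with [E] known from shorter
   words. A nonzero homology class of [E] can only be absorbed by [f_n]; what remains is a boundary,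
   absorbed by [g_n]. That [E] is a cycle is where the Bianchi identity and the vanishing of the
   defect of [f] at the same length enter. Minimality of the source keeps [g_n] from entering
   through [b]. *)
From HB Require Import structures.
Require Import Defs.
From mathcomp Require Import all_boot all_order all_algebra.
From mathcomp Require Import boolp classical_sets zify ring.

Set Implicit Arguments.
Unset Strict Implicit.
Unset Printing Implicit Defensive.

Import GRing.Theory.
Local Open Scope ring_scope.

(** * Splittings of words *)

Section Splits.
Variables (T : eqType) (X : zmodType).
Implicit Types (xs u v w : seq T) (G : seq T -> seq T -> X).

Fixpoint splits xs : seq (seq T * seq T) :=
  if xs is x :: xs' then
    ([::], xs) :: [seq (x :: p.1, p.2) | p <- splits xs']
  else [:: ([::], [::])].

Definition ssum G xs : X := \sum_(p <- splits xs) G p.1 p.2.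

(** The left part is nonempty because no operation acts on the empty factor; hence peeling off a
    first block shortens the word. *)
Definition psum G xs : X := \sum_(p <- behead (splits xs)) G p.1 p.2.

Lemma ssum_nil G : ssum G [::] = G [::] [::].
Proof. by rewrite /ssum big_seq1. Qed.

Lemma ssum_cons G x xs :
  ssum G (x :: xs) = G [::] (x :: xs) + ssum (fun u => G (x :: u)) xs.
Proof. by rewrite /ssum /= big_cons big_map. Qed.

Lemma psum_nil G : psum G [::] = 0.
Proof. by rewrite /psum big_nil. Qed.

Lemma psum_cons G x xs : psum G (x :: xs) = ssum (fun u => G (x :: u)) xs.
Proof. by rewrite /psum /ssum /= big_map. Qed.

Lemma ssumE G xs : ssum G xs = G [::] xs + psum G xs.
Proof.
by case: xs => [|x xs]; rewrite ?ssum_nil ?psum_nil ?addr0 // ssum_cons psum_cons.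
Qed.

Lemma eq_ssum G G' xs : (forall u v, u ++ v = xs -> G u v = G' u v) ->
  ssum G xs = ssum G' xs.
Proof.
elim: xs G G' => [|x xs IH] G G' h; first by rewrite !ssum_nil h.
rewrite !ssum_cons h // (IH _ (fun u => G' (x :: u))) // => u v e.
by rewrite h //= e.
Qed.

Lemma eq_psum G G' xs :
  (forall u v, u ++ v = xs -> u != [::] -> G u v = G' u v) ->
  psum G xs = psum G' xs.
Proof.
case: xs => [|x xs] h; first by rewrite !psum_nil.
by rewrite !psum_cons; apply: eq_ssum => u v e; rewrite h //= e.
Qed.

Lemma ssumD G G' xs : ssum (fun u v => G u v + G' u v) xs = ssum G xs + ssum G' xs.
Proof. exact: big_split. Qed.

Lemma psumD G G' xs : psum (fun u v => G u v + G' u v) xs = psum G xs + psum G' xs.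
Proof. exact: big_split. Qed.

Lemma ssumN G xs : ssum (fun u v => - G u v) xs = - ssum G xs.
Proof. by rewrite /ssum sumrN. Qed.

Lemma psumN G xs : psum (fun u v => - G u v) xs = - psum G xs.
Proof. by rewrite /psum sumrN. Qed.

Lemma ssum_eq0 G xs : (forall u v, u ++ v = xs -> G u v = 0) -> ssum G xs = 0.
Proof. by move=> h; rewrite (eq_ssum (G' := fun _ _ => 0)) // /ssum big1. Qed.

Lemma psum_eq0 G xs : (forall u v, u ++ v = xs -> u != [::] -> G u v = 0) ->
  psum G xs = 0.
Proof. by move=> h; rewrite (eq_psum (G' := fun _ _ => 0)) // /psum big1. Qed.

Lemma ssum_last G xs :
  ssum G xs = ssum (fun u v => if v is [::] then 0 else G u v) xs + G xs [::].
Proof.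
elim: xs G => [|x xs IH] G; first by rewrite !ssum_nil add0r.
by rewrite !ssum_cons IH addrA.
Qed.

Lemma psum_last G xs : xs != [::] ->
  psum G xs = psum (fun u v => if v is [::] then 0 else G u v) xs + G xs [::].
Proof. by case: xs => // x xs _; rewrite !psum_cons ssum_last. Qed.

Lemma ssum_mid G u y t : ssum G (u ++ y :: t) =
  ssum (fun a b => G a (b ++ y :: t)) u + ssum (fun a b => G (u ++ y :: a) b) t.
Proof.
elim: u G => [|x u IH] G; first by rewrite ssum_nil /= ssum_cons.
by rewrite /= !ssum_cons IH addrA.
Qed.

Lemma psum_mid G u y t : psum G (u ++ y :: t) =
  psum (fun a b => G a (b ++ y :: t)) u + ssum (fun a b => G (u ++ y :: a) b) t.
Proof.
case: u => [|x u]; first by rewrite psum_nil add0r psum_cons.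
by rewrite /= !psum_cons ssum_mid.
Qed.

(** Coassociativity of deconcatenation: both sides run over the cuts of the word into three
    factors. *)
Lemma ssumA (G : seq T -> seq T -> seq T -> X) xs :
  ssum (fun u w => ssum (fun a b => G a b w) u) xs =
  ssum (fun a w => ssum (fun b c => G a b c) w) xs.
Proof.
elim: xs G => [|x xs IH] G; first by rewrite !ssum_nil.
rewrite !ssum_cons ssum_nil -addrA; congr (_ + _).
rewrite -IH -ssumD; apply: eq_ssum => u v _.
by rewrite ssum_cons.
Qed.

Lemma psumA (G : seq T -> seq T -> seq T -> X) xs :
  psum (fun u w => psum (fun a b => G a b w) u) xs =
  psum (fun a w => ssum (fun b c => G a b c) w) xs.
Proof.
case: xs => [|x xs]; first by rewrite !psum_nil.
rewrite !psum_cons -(ssumA (fun a => G (x :: a))); apply: eq_ssum => u v _.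
by rewrite psum_cons.
Qed.

Lemma ssum_psumA (G : seq T -> seq T -> seq T -> X) xs :
  ssum (fun u w => psum (fun a b => G a b w) u) xs =
  psum (fun a w => ssum (fun b c => G a b c) w) xs.
Proof. by rewrite ssumE psum_nil add0r psumA. Qed.

Lemma ssumE_nat G xs :
  ssum G xs = \sum_(0 <= r < (size xs).+1) G (take r xs) (drop r xs).
Proof.
elim: xs G => [|x xs IH] G; first by rewrite ssum_nil big_nat1.
by rewrite ssum_cons IH [RHS]big_nat_recl.
Qed.

Lemma psumE_nat G xs :
  psum G xs = \sum_(1 <= s < (size xs).+1) G (take s xs) (drop s xs).
Proof.
case: xs => [|x xs]; first by rewrite psum_nil big_geq.
by rewrite psum_cons ssumE_nat [RHS]big_add1.
Qed.

End Splits.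

Lemma ssum_map (T T' : eqType) (X : zmodType) (h : T' -> T)
    (G : seq T -> seq T -> X) xs :
  ssum G (map h xs) = ssum (fun u v => G (map h u) (map h v)) xs.
Proof.
elim: xs G => [|x xs IH] G; first by rewrite !ssum_nil.
by rewrite /= !ssum_cons IH.
Qed.

Lemma psum_map (T T' : eqType) (X : zmodType) (h : T' -> T)
    (G : seq T -> seq T -> X) xs :
  psum G (map h xs) = psum (fun u v => G (map h u) (map h v)) xs.
Proof.
by case: xs => [|x xs]; rewrite ?psum_nil //= !psum_cons ssum_map.
Qed.

Lemma ssum_psum_exchange (T T' : eqType) (X : zmodType)
    (G : seq T -> seq T -> seq T' -> seq T' -> X) xs ys :
  ssum (fun a b => psum (fun c d => G a b c d) ys) xs =
  psum (fun c d => ssum (fun a b => G a b c d) xs) ys.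
Proof. by rewrite /ssum /psum exchange_big. Qed.

Lemma psum_exchange (T T' : eqType) (X : zmodType)
    (G : seq T -> seq T -> seq T' -> seq T' -> X) xs ys :
  psum (fun a b => psum (fun c d => G a b c d) ys) xs =
  psum (fun c d => psum (fun a b => G a b c d) xs) ys.
Proof. by rewrite /psum exchange_big. Qed.

(* The two ways of marking a nonempty factor [v] of a word and a factor [m]
   containing it. *)
Lemma split_regroup (T : eqType) (X : zmodType)
    (G : seq T -> seq T -> seq T -> seq T -> seq T -> X) xs :
  ssum (fun u w => psum (fun v t =>
    ssum (fun a c => ssum (fun e e' => G a c v e e') t) u) w) xs =
  ssum (fun a w => psum (fun m e' =>
    ssum (fun c w' => psum (fun v e => G a c v e e') w') m) w) xs.
Proof.
under eq_ssum => u w _ do rewrite -ssum_psum_exchange.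
rewrite ssumA; apply: eq_ssum => a w _.
under eq_ssum => c w' _ do rewrite -psumA.
(* As [H] vanishes for empty [q], the sum over nonempty [q] is completed to a full one, to which
   [ssumA] applies. *)
pose H c q e' := psum (fun v e => G a c v e e') q.
transitivity (ssum (fun c w' => ssum (fun q e' => H c q e') w') w).
  by apply: eq_ssum => c w' _; rewrite ssumE /H psum_nil add0r.
by rewrite -(ssumA H) ssumE ssum_nil /H psum_nil add0r.
Qed.

(** * Words cut into blocks, and composition of families *)

Section Composition.
Variables (T T' : eqType) (X : zmodType).
Implicit Types (xs u v w : seq T) (f : seq T -> T') (phi : seq T' -> X).

(* The decompositions of a word into nonempty blocks. *)
Fixpoint cuts (S : Type) (xs : seq S) : seq (seq (seq S)) :=
  if xs is x :: xs' then
    if xs' is [::] then [:: [:: [:: x]]] else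
    [seq [:: x] :: c | c <- cuts xs'] ++
    [seq (x :: head [::] c) :: behead c | c <- cuts xs']
  else [:: [::]].

(* [phi] precomposed with the coalgebra morphism induced by [f]. *)
Definition pull f phi xs : X := \sum_(c <- cuts xs) phi (map f c).

Lemma pull_nil f phi : pull f phi [::] = phi [::].
Proof. by rewrite /pull big_seq1. Qed.

Lemma sum_cuts (H : seq (seq T) -> X) x xs : \sum_(c <- cuts (x :: xs)) H c =
  ssum (fun u w => \sum_(c <- cuts w) H ((x :: u) :: c)) xs.
Proof.
elim: xs x H => [|y xs IH] x H; first by rewrite ssum_nil /= !big_seq1.
have -> : cuts (x :: y :: xs) = [seq [:: x] :: c | c <- cuts (y :: xs)] ++
  [seq (x :: head [::] c) :: behead c | c <- cuts (y :: xs)] by [].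
by rewrite big_cat !big_map ssum_cons !IH.
Qed.

Lemma pull_psum f phi xs : xs != [::] ->
  pull f phi xs = psum (fun u w => pull f (fun ws => phi (f u :: ws)) w) xs.
Proof. by case: xs => // x xs _; rewrite psum_cons /pull sum_cuts. Qed.

Lemma eq_pullr f phi psi xs : phi =1 psi -> pull f phi xs = pull f psi xs.
Proof. by move=> e; apply: eq_bigr => c _. Qed.

Lemma pullD f phi psi xs :
  pull f (fun ws => phi ws + psi ws) xs = pull f phi xs + pull f psi xs.
Proof. exact: big_split. Qed.

Lemma size_psplit xs u v : u ++ v = xs -> u != [::] -> (size v < size xs)%N.
Proof. by move=> <-; rewrite size_cat; case: u => //= x u _; lia. Qed.

Lemma eq_pull f f' phi phi' xs :
  (forall u, u != [::] -> (size u <= size xs)%N -> f u = f' u) ->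
  (forall ws, (size ws <= size xs)%N -> (xs != [::] -> ws != [::]) ->
     phi ws = phi' ws) ->
  pull f phi xs = pull f' phi' xs.
Proof.
have [n] := ubnP (size xs); elim: n => // n IH in xs phi phi' *.
move=> sn hf hphi; have [xs0|xs0] := eqVneq xs [::].
  by rewrite xs0 !pull_nil hphi // xs0.
rewrite !pull_psum //; apply: eq_psum => u v e u0.
have sv := size_psplit e u0.
rewrite hf //; last by rewrite -e size_cat leq_addr.
apply: IH => [|w w0 sw|ws sws _].
- by apply: leq_trans sv _; rewrite -ltnS.
- by apply: hf => //; apply: leq_trans sw (ltnW sv).
by apply: hphi => //=; apply: leq_ltn_trans sws sv.
Qed.

Lemma pull_eq0 f phi xs : (forall ws, (size ws <= size xs)%N -> phi ws = 0) ->
  pull f phi xs = 0.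
Proof.
move=> h; rewrite (eq_pull (f' := f) (phi' := fun=> 0)) //; first exact: big1.
by move=> ws sws _; apply: h.
Qed.

(** Every cut other than the one into single letters has fewer blocks than the word has letters. *)
Lemma pull_letters f phi xs :
  (forall ws, (size ws < size xs)%N -> phi ws = 0) ->
  pull f phi xs = phi [seq f [:: x] | x <- xs].
Proof.
elim: xs phi => [|x xs IH] phi h; first by rewrite pull_nil.
rewrite pull_psum // psum_cons ssumE IH //= => [|ws sws]; last exact: h.
rewrite psum_eq0 ?addr0 // => u v e u0; apply: pull_eq0 => ws sws; apply: h => /=.
by rewrite ltnS; apply: leq_ltn_trans sws (size_psplit e u0).
Qed.

(** Coalgebra morphisms respect deconcatenation: to cut the word of blocks in two is to cut [xs]
    first and then each half into blocks. *)
Lemma pull_split f (G : seq T' -> seq T' -> X) xs :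
  pull f (ssum G) xs =
  ssum (fun u v => pull f (fun a => pull f (G a) v) u) xs.
Proof.
have [n] := ubnP (size xs); elim: n => // n IH in xs G *; move=> sn.
have [->|xs0] := eqVneq xs [::]; first by rewrite ssum_nil !pull_nil ssum_nil.
rewrite ssumE pull_nil [LHS]pull_psum // [X in _ + X](_ : _ =
    psum (fun u w => psum (fun a b =>
      pull f (fun ws => pull f (G (f a :: ws)) w) b) u) xs); last first.
  by apply: eq_psum => u v e u0; rewrite pull_psum.
rewrite psumA [pull f (G [::]) xs]pull_psum // -psumD; apply: eq_psum => u v e u0.
rewrite (eq_pullr _ _ (fun ws => ssum_cons G (f u) ws)) pullD; congr (_ + _).
by apply: IH; apply: leq_trans (size_psplit e u0) _; rewrite -ltnS.
Qed.

Lemma pull_psplit f (G : seq T' -> seq T' -> X) xs :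
  pull f (psum G) xs =
  psum (fun u v => pull f (fun a => pull f (G a) v) u) xs.
Proof.
have := pull_split f G xs; rewrite [RHS]ssumE pull_nil.
by rewrite (eq_pullr _ _ (fun ws => ssumE G ws)) pullD => /addrI.
Qed.

(** The letter [y] lies in exactly one block, made of a suffix of [u], [y] and a prefix of [t]; the
    two remaining ends are cut independently. *)
Lemma pull_mid f phi u y t : pull f phi (u ++ y :: t) =
  ssum (fun u1 u2 => ssum (fun t1 t2 =>
    pull f (fun a => pull f (fun c => phi (a ++ f (u2 ++ y :: t1) :: c)) t2) u1)
  t) u.
Proof.
have [n] := ubnP (size u); elim: n => // n IH in u phi *; move=> sn.
rewrite pull_psum; last by case: u {sn}.
rewrite psum_mid addrC [RHS]ssumE; congr (_ + _).
  by apply: eq_ssum => a b _; rewrite pull_nil.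
rewrite (eq_psum (G' := fun a b => ssum (fun u1 u2 => ssum (fun t1 t2 =>
    pull f (fun a' => pull f (fun c =>
      phi (f a :: a' ++ f (u2 ++ y :: t1) :: c)) t2) u1) t) b)); last first.
  move=> a b e a0; rewrite IH //.
  by apply: leq_trans (size_psplit e a0) _; rewrite -ltnS.
rewrite -psumA; apply: eq_psum => a b _ a0.
rewrite -[LHS]ssum_psum_exchange; apply: eq_ssum => u1 u2 _.
by rewrite pull_psum.
Qed.

End Composition.

(** * Linear algebra: quasi-inverses and graded extension *)

Section LinearFunctions.
Variables (k : fieldType) (V W : lmodType k).

Definition linear_of (f : V -> W) (fl : linear f) : {linear V -> W} :=
  HB.pack f (GRing.isLinear.Build k V W _ f fl).

Variables (f : V -> W) (fl : linear f).

Lemma lin0 : f 0 = 0. Proof. exact: (linear0 (linear_of fl)). Qed.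
Lemma linN : {morph f : x / - x}. Proof. exact: (linearN (linear_of fl)). Qed.
Lemma linD : {morph f : x y / x + y}. Proof. exact: (linearD (linear_of fl)). Qed.
Lemma linB : {morph f : x y / x - y}. Proof. exact: (linearB (linear_of fl)). Qed.
Lemma linZ a : {morph f : x / a *: x}. Proof. exact: (linearZ_LR (linear_of fl)). Qed.
Lemma lin_sum I (r : seq I) (P : pred I) (F : I -> V) :
  f (\sum_(i <- r | P i) F i) = \sum_(i <- r | P i) f (F i).
Proof. exact: (linear_sum (linear_of fl)). Qed.

End LinearFunctions.

Lemma sum_linear (k : fieldType) (V W : lmodType k) I (r : seq I) (F : I -> V -> W) :
  (forall i, linear (F i)) -> linear (fun x => \sum_(i <- r) F i x).
Proof.
move=> h a x y; rewrite scaler_sumr -big_split /=; apply: eq_bigr => i _.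
exact: h.
Qed.

Local Open Scope classical_set_scope.

(* Zorn's lemma on the partial linear right inverses of [D]. *)
Lemma linear_quasi_inverse (k : fieldType) (V W : lmodType k)
    (D : {linear V -> W}) :
  exists h : {linear W -> V}, forall x, D (h (D x)) = D x.
Proof.
(* [G] is the graph of a partial linear map from [W] to [V]. The last clause asks for a right
   inverse only over the image of [D], so that a maximal graph can have full domain. *)
pose P (G : set (W * V)) := [/\ G (0, 0),
  forall a p q, G p -> G q -> G (a *: p + q),
  forall y x x', G (y, x) -> G (y, x') -> x = x' &
  forall y x, G (y, x) -> (exists z, D z = y) -> D x = y].
pose P' (G : set (W * V)) := G = set0 \/ P G.
have [|G [PG maxG]] := @Zorn_bigcup _ P'.
  move=> F FP tot; have [[G0 FG0 G0n]|no] := pselect (exists2 G, F G & P G); last first.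
    left; apply/seteqP; split=> // p [G FG Gp].
    have [G0|PG] := FP _ FG; first by rewrite G0 in Gp.
    by case: no; exists G.
  have PF G p : F G -> G p -> P G.
    by move=> /FP[->|].
  right; split.
  - by exists G0 => //; case: G0n.
  - move=> a p q [G FG Gp] [G' FG' Gq].
    have [sub|sub] := tot _ _ FG FG'.
      exists G' => //; have [_ h _ _] := PF _ _ FG' Gq; apply: h => //.
      exact: sub.
    exists G => //; have [_ h _ _] := PF _ _ FG Gp; apply: h => //.
    exact: sub.
  - move=> y x x' [G FG Gp] [G' FG' Gq].
    have [sub|sub] := tot _ _ FG FG'.
      have [_ _ h _] := PF _ _ FG' Gq; apply: h Gq; exact: sub.
    have [_ _ h _] := PF _ _ FG Gp; apply: h; [exact: Gp | exact: sub].
  - by move=> y x [G FG Gp]; have [_ _ _ h] := PF _ _ FG Gp; apply: h.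
have {PG}PG : P G.
  case: PG => // G0; exfalso.
  apply: (maxG [set (0, 0)]).
    rewrite G0; split=> // h; exact: (h (0, 0)).
  right; split=> //=.
  - by move=> a p q -> ->; rewrite scaler0 addr0.
  - by move=> y x x' [_ ->] [_ ->].
  - by move=> y x [-> ->] _; rewrite linear0.
have [G0 Glin Gfun Ginv] := PG.
have Gtot y0 : exists x, G (y0, x).
  apply: contrapT => ndom.
  (* The value at a new point [y0]. If some [y0 + y'] with [y'] in the domain equals [D z], take
     [z - x']; by linearity of [G] this choice serves all such [y']. Otherwise there is no
     constraint and 0 will do. *)
  have [x0 hx0] : exists x0, forall y' x', G (y', x') ->
      (exists z, D z = y0 + y') -> D (x0 + x') = y0 + y'.
    have [[y' [x' [z [Gp ez]]]]|no] := pselect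
        (exists y' x' z, G (y', x') /\ D z = y0 + y').
      exists (z - x') => y x Gyx [w ew].
      have G1 : G (y - y', x - x').
        rewrite -[(_, _)]/((y, x) - (y', x')) addrC -scaleN1r.
        exact: Glin.
      have e1 : D (x - x') = y - y'.
        apply: Ginv G1 _; exists (w - z).
        by rewrite linearB /= ew ez opprD addrACA subrr add0r.
      by rewrite addrAC -addrA linearD /= e1 ez addrACA subrr addr0.
    by exists 0 => y' x' Gp [z ez]; case: no; exists y', x', z.
  pose G' : set (W * V) := [set p | exists a q, G q /\ p = a *: (y0, x0) + q].
  have GG' : G `<=` G'.
    by move=> q Gq; exists 0, q; rewrite scale0r add0r.
  have G'0 : G' (y0, x0).
    by exists 1, (0, 0); split => //; rewrite scale1r addr0.
  apply: (maxG G').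
    by split=> // h; apply: ndom; exists x0; exact: h.
  have dom0 a y x : G (y, x) -> a *: y0 + y = 0 -> a = 0.
    move=> Gyx /eqP; rewrite addr_eq0 => /eqP e; apply: contrapT => /eqP a0.
    apply: ndom; exists (- a^-1 *: x).
    have -> : (y0, - a^-1 *: x) = (- a^-1) *: (y, x) + 0.
      rewrite addr0; congr (_, _) => /=.
      by rewrite scaleNr -scalerN -e scalerA mulVf // scale1r.
    exact: Glin.
  right; split.
  - exact: GG'.
  - move=> a _ _ [b [q [Gq ->]]] [c [r [Gr ->]]].
    exists (a * b + c), (a *: q + r); split; first exact: Glin.
    by rewrite scalerDr scalerDl scalerA addrACA.
  - move=> y x x' [a [[y1 x1] [G1 [e1 e2]]]] [b [[y2 x2] [G2 [e3 e4]]]].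
    have G3 : G (y1 - y2, x1 - x2).
      rewrite -[(_, _)]/((y1, x1) - (y2, x2)) addrC -scaleN1r.
      exact: Glin.
    have ab : a - b = 0.
      apply: dom0 G3 _; rewrite scalerBl addrACA -opprD -e1 -e3 subrr //.
    have {}ab : a = b by apply/eqP; rewrite -subr_eq0 ab.
    have ey : y1 = y2 by apply: (@addrI _ (a *: y0)); rewrite -e1 e3 ab.
    rewrite -ey in G2.
    by rewrite e2 e4 ab (Gfun _ _ _ G1 G2).
  - move=> y x [a [[y1 x1] [G1 [-> ->]]]] [z ez] /=.
    have [a0|a0] := eqVneq a 0.
      rewrite a0 !scale0r !add0r; apply: Ginv G1 _.
      by exists z; rewrite ez a0 scale0r add0r.
    have G2 : G (a^-1 *: y1, a^-1 *: x1).
      by have := Glin a^-1 _ _ G1 G0; rewrite addr0.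
    have := hx0 _ _ G2; move=> /(_ _)/(congr1 ( *:%R a)).
    rewrite !scalerDr !scalerA -linearZ /= scalerDr scalerA mulfV // !scale1r.
    by apply; exists (a^-1 *: z); rewrite linearZ /= ez scalerDr scalerA mulVf // scale1r.
have [h hP] := choice Gtot.
have hlin : linear h.
  move=> a y y'; apply: (Gfun (a *: y + y')) => //.
  exact: (Glin a _ _ (hP y) (hP y')).
by exists (linear_of hlin) => x /=; apply: Ginv (hP _) _; exists x.
Qed.

Local Close Scope classical_set_scope.

Lemma sum_support (I : eqType) (X : nmodType) (r u : seq I) (F : I -> X) :
  uniq r -> uniq u -> {subset r <= u} -> (forall j, j \notin r -> F j = 0) ->
  \sum_(j <- u) F j = \sum_(j <- r) F j.
Proof.
move=> ur uu ru F0; rewrite (bigID (mem r)) /= [X in _ + X]big1 ?addr0 // -big_filter.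
apply: perm_big; apply: uniq_perm => [||j] //; first exact: filter_uniq.
by rewrite mem_filter /=; case: (boolP (j \in r)) => // /ru.
Qed.

Section GradedExtension.
Variables (k : fieldType) (V : gradedSpace k).

Lemma homog_unique (s t : seq int) (c b : int -> V) :
  uniq s -> uniq t -> (forall i, homog i (c i)) -> (forall i, homog i (b i)) ->
  \sum_(i <- s) c i = \sum_(i <- t) b i ->
  forall i, (if i \in s then c i else 0) = (if i \in t then b i else 0).
Proof.
move=> us ut hc hb e i.
pose cut (r : seq int) (a : int -> V) j := if j \in r then a j else 0.
have hcut r a j : (forall j, homog j (a j)) -> homog j (cut r a j).
  by move=> ha; rewrite /cut; case: ifP => _; [exact: ha | exact: homog0].
pose u := undup (s ++ t).
have uu : uniq u := undup_uniq _.
have sub r a : uniq r -> {subset r <= u} ->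
    \sum_(j <- u) cut r a j = \sum_(j <- r) a j.
  move=> ur ru; rewrite (sum_support ur uu ru) => [|j /negbTE jr].
    by apply: eq_big_seq => j; rewrite /cut => ->.
  by rewrite /cut jr.
have [iu|iu] := boolP (i \in u); last first.
  move: iu; rewrite mem_undup mem_cat negb_or => /andP[/negbTE-> /negbTE->] //.
apply/eqP; rewrite -subr_eq0; apply/eqP.
apply: (@homog_free _ V u (fun j => cut s c j - cut t b j)) => //.
- by move=> j; apply: homogB; apply: hcut.
- rewrite sumrB !sub ?e ?subrr // => j jr; rewrite mem_undup mem_cat jr ?orbT //.
Qed.

(** Allows linear maps to be defined by formulas that mention the degree, such as signs and
    projections; [homog_unique] gives independence of the decomposition. *)
Lemma graded_extension (W : lmodType k) (g : int -> V -> W) :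
  (forall i, linear (g i)) ->
  exists G : {linear V -> W}, forall i x, homog i x -> G x = g i x.
Proof.
move=> gl; have [|D hD] := @choice _ _ (fun x (d : seq int * (int -> V)) =>
    [/\ uniq d.1, forall i, homog i (d.2 i), forall i, i \notin d.1 -> d.2 i = 0
      & x = \sum_(i <- d.1) d.2 i]).
  by move=> x; have [s [c h]] := homog_dec x; exists (s, c).
pose G x := \sum_(i <- (D x).1) g i ((D x).2 i).
have GE x s c : uniq s -> (forall i, homog i (c i)) -> x = \sum_(i <- s) c i ->
    G x = \sum_(i <- s) g i (c i).
  move=> us hc e; have [ud hd d0 ed] := hD x.
  pose u := undup (s ++ (D x).1).
  have ext r (a : int -> V) : uniq r -> {subset r <= u} ->
      \sum_(j <- r) g j (a j) = \sum_(j <- u) g j (if j \in r then a j else 0).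
    move=> ur ru; rewrite (sum_support ur (undup_uniq _) ru) => [|j /negbTE->].
      by apply: eq_big_seq => j ->.
    by rewrite lin0.
  rewrite /G (ext _ (D x).2 ud) => [|j jr]; last by rewrite mem_undup mem_cat jr orbT.
  rewrite (ext _ c us) => [|j jr]; last by rewrite mem_undup mem_cat jr.
  apply: eq_bigr => i _; congr (g i _); apply: homog_unique => //.
  by rewrite -ed.
have Gl : linear G.
  move=> a x y; have [ux hx x0 ex] := hD x; have [uy hy y0 ey] := hD y.
  pose u := undup ((D x).1 ++ (D y).1).
  have uu : uniq u := undup_uniq _.
  rewrite -(sum_support ux uu _ x0) in ex => [|j jr]; last by rewrite mem_undup mem_cat jr.
  rewrite -(sum_support uy uu _ y0) in ey => [|j jr]; last by rewrite mem_undup mem_cat jr orbT.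
  rewrite (GE x _ _ uu hx ex) (GE y _ _ uu hy ey) scaler_sumr -big_split /=.
  rewrite (GE _ u (fun i => a *: (D x).2 i + (D y).2 i) uu).
  - by apply: eq_bigr => i _; rewrite gl.
  - by move=> i; apply: homogP.
  - by rewrite {1}ex {1}ey scaler_sumr -big_split.
exists (linear_of Gl) => i x hx /=.
rewrite (GE x [:: i] (fun j => if j == i then x else 0)) ?big_seq1 ?eqxx //.
by move=> j; case: eqP => [->|_] //; exact: homog0.
Qed.

Lemma homog_lin_ext (W : lmodType k) (f g : V -> W) : linear f -> linear g ->
  (forall i x, homog i x -> f x = g x) -> f =1 g.
Proof.
move=> fl gl e x; have [s [c [_ hc ->]]] := homog_span x.
by rewrite (lin_sum fl) (lin_sum gl); apply: eq_bigr => i _; exact: (e i).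
Qed.

Lemma homogZ i (a : k) (x : V) : homog i x -> homog i (a *: x).
Proof.
by move=> hx; rewrite -[_ *: _]addr0; apply: homogP => //; exact: homog0.
Qed.

Lemma homogD i (x y : V) : homog i x -> homog i y -> homog i (x + y).
Proof. by move=> hx hy; rewrite -[x]scale1r; apply: homogP. Qed.

Lemma homogN i (x : V) : homog i x -> homog i (- x).
Proof. by move=> hx; rewrite -scaleN1r; apply: homogZ. Qed.

Lemma homog_sum I (r : seq I) i (F : I -> V) :
  (forall j, homog i (F j)) -> homog i (\sum_(j <- r) F j).
Proof.
move=> h; elim/big_ind: _ => [|x y|j _] //; first exact: homog0.
exact: homogD.
Qed.

Lemma homog_proj : exists pr : int -> {linear V -> V},
  [/\ forall i x, homog i (pr i x), forall i x, homog i x -> pr i x = x &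
      forall i j x, homog i x -> i != j -> pr j x = 0].
Proof.
have [|pr hpr] := @choice _ _ (fun j (G : {linear V -> V}) =>
    forall i x, homog i x -> G x = if i == j then x else 0).
  move=> j; apply: (@graded_extension V (fun i x => if i == j then x else 0)).
  by move=> i a x y; case: eqP => // _; rewrite scaler0 addr0.
exists pr; split=> [i x|i x hx|i j x hx /negbTE ij].
- have [s [c [_ hc ->]]] := homog_span x.
  rewrite linear_sum; apply: homog_sum => j; rewrite (hpr _ _ _ (hc j)).
  by case: eqP => [<-|_] //; exact: homog0.
- by rewrite (hpr _ _ _ hx) eqxx.
- by rewrite (hpr _ _ _ hx) ij.
Qed.

End GradedExtension.

Section Contraction.
Variables (k : fieldType) (C : chainComplex k).
Local Notation d := (@cx_d k C).

(** Only the component of degree 1 of an ungraded quasi-inverse is kept. As [d] carries the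
    projection to one degree into the projection to the next lower one, this component is still a
    quasi-inverse. *)
Lemma graded_quasi_inverse : exists h : {linear C -> C},
  (forall i x, homog i x -> homog (i + 1) (h x)) /\ forall x, d (h (d x)) = d x.
Proof.
have [h0 h0P] := linear_quasi_inverse (linear_of (@cx_d_linear k C)).
have [pr [prh pr1 pr0]] := homog_proj C.
have [|h hE] := @graded_extension k C C (fun i x => pr (i + 1) (h0 x)).
  by move=> i a x y; rewrite !linearP.
have dpr i x : d (pr i x) = pr (i - 1) (d x).
  have dprl : linear (fun x => d (pr i x)).
    by move=> a u v; rewrite linearP cx_d_linear.
  have prdl : linear (fun x => pr (i - 1) (d x)).
    by move=> a u v; rewrite cx_d_linear linearP.
  apply: (homog_lin_ext dprl prdl) => j y hy.
  have [ij|ij] := eqVneq j i.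
    rewrite -ij (pr1 _ _ hy) pr1 //; exact: cx_d_degree.
  rewrite (pr0 _ _ _ hy ij) (pr0 _ _ _ (cx_d_degree hy)) ?(lin0 (@cx_d_linear k C)) //.
  by apply: contra ij => /eqP/addIr->.
exists h; split=> [i x hx|]; first by rewrite (hE _ _ hx).
have l1 : linear (fun x => d (h (d x))).
  by move=> a u v; rewrite cx_d_linear linearP cx_d_linear.
apply: (homog_lin_ext l1 (@cx_d_linear k C)) => i x hx.
rewrite (hE _ _ (cx_d_degree hx)) subrK dpr.
have := h0P x; rewrite /= => ->.
by apply: pr1; exact: cx_d_degree.
Qed.

End Contraction.

(** * Parity, multilinear functions, insertion *)

Section Parity.
Variables (k : fieldType).

Lemma signz_odd (z : int) : (-1 : k) ^ z = (-1) ^+ odd `|z|%N.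
Proof. by case: z => n; rewrite ?NegzE -?exprnN ?invr_sign signr_odd //= -signr_odd. Qed.

Lemma odd_abszD (x y : int) : odd (absz (x + y)) = odd (absz x) (+) odd (absz y).
Proof. lia. Qed.

Lemma odd_abszM (x y : int) : odd (absz (x * y)) = odd (absz x) && odd (absz y).
Proof. by rewrite abszM oddM. Qed.

Lemma signzD (x y : int) : (-1 : k) ^ (x + y) = (-1) ^ x * (-1) ^ y.
Proof. by rewrite expfzDr // oppr_eq0 oner_eq0. Qed.

Lemma signz_sqr (x : int) : (-1 : k) ^ x * (-1) ^ x = 1.
Proof. by rewrite signz_odd -expr2 sqrr_sign. Qed.

Lemma signz_eq (x y : int) : odd `|x|%N = odd `|y|%N -> (-1 : k) ^ x = (-1) ^ y.
Proof. by rewrite !signz_odd => ->. Qed.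

End Parity.

Section Tau.
Variables (k : fieldType) (V : gradedSpace k).

Fact tau_ex : exists G : {linear V -> V},
  forall i x, homog i x -> G x = (-1 : k) ^ (i + 1) *: x.
Proof.
apply: (@graded_extension k V V (fun i x => (-1) ^ (i + 1) *: x)) => i a x y.
by rewrite scalerDr !scalerA mulrC.
Qed.

(* The parity involution of the suspension of [V]. *)
Definition tau : {linear V -> V} := projT1 (cid tau_ex).

Lemma tauE i x : homog i x -> tau x = (-1 : k) ^ (i + 1) *: x.
Proof. exact: (projT2 (cid tau_ex)). Qed.

Lemma tauK x : tau (tau x) = x.
Proof.
have l : linear (fun x => tau (tau x)) by move=> a u v; rewrite !linearP.
have l1 : linear (fun x : V => x) by [].
apply: (homog_lin_ext l l1) => i y hy.
by rewrite (tauE hy) linearZ /= (tauE hy) scalerA signz_sqr scale1r.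
Qed.

Lemma map_tauK (xs : seq V) : map tau (map tau xs) = xs.
Proof. by rewrite mapK //; exact: tauK. Qed.

Lemma tau_homog i x : homog i x -> homog i (tau x).
Proof. by move=> hx; rewrite (tauE hx); apply: homogZ. Qed.

End Tau.

Arguments tau {k V}.

Section Scale.
Variables (k : fieldType) (T : eqType) (X : lmodType k).
Implicit Type G : seq T -> seq T -> X.

Lemma ssum_linear (Y : lmodType k) (F : seq T -> seq T -> X -> Y) xs :
  (forall u v, linear (F u v)) -> linear (fun x => ssum (fun u v => F u v x) xs).
Proof. by move=> h; apply: sum_linear => p; exact: h. Qed.

Lemma psum_linear (Y : lmodType k) (F : seq T -> seq T -> X -> Y) xs :
  (forall u v, linear (F u v)) -> linear (fun x => psum (fun u v => F u v x) xs).
Proof. by move=> h; apply: sum_linear => p; exact: h. Qed.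

Lemma ssum_lin (Y : lmodType k) (L : X -> Y) G xs :
  linear L -> L (ssum G xs) = ssum (fun u v => L (G u v)) xs.
Proof. by move=> hL; exact: lin_sum. Qed.

Lemma psum_lin (Y : lmodType k) (L : X -> Y) G xs :
  linear L -> L (psum G xs) = psum (fun u v => L (G u v)) xs.
Proof. by move=> hL; exact: lin_sum. Qed.

End Scale.

Section Multilinear.
Variables (k : fieldType) (V W : gradedSpace k).
Implicit Types (phi psi : seq V -> W).

Lemma multilinear0 phi s t : multilinear phi -> phi (s ++ 0 :: t) = 0.
Proof. by move=> h; exact: (lin0 (h s t)). Qed.

Lemma multilinear_cons phi x : multilinear phi -> multilinear (fun ws => phi (x :: ws)).
Proof. by move=> h s t; exact: (h (x :: s) t). Qed.

Lemma multilinear_catl phi l : multilinear phi -> multilinear (fun ws => phi (l ++ ws)).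
Proof.
move=> h s t; have := h (l ++ s) t.
by under eq_fun do rewrite -catA.
Qed.

Lemma multilinear_catr phi r : multilinear phi -> multilinear (fun ws => phi (ws ++ r)).
Proof.
move=> h s t; have := h s (t ++ r).
by under [X in _ -> linear X]eq_fun do rewrite -catA.
Qed.

Lemma multilinear_map (U : gradedSpace k) (h : {linear U -> V}) phi :
  multilinear phi -> multilinear (fun ws : seq U => phi (map h ws)).
Proof.
move=> hphi s t a x y; rewrite !map_cat /= linearP; exact: hphi.
Qed.

Lemma multilinear_lin (U : gradedSpace k) (L : W -> U) phi :
  linear L -> multilinear phi -> multilinear (fun ws => L (phi ws) : U).
Proof. by move=> hL h s t a x y; rewrite h hL. Qed.

Lemma multilinear_zero : multilinear (fun _ : seq V => 0 : W).
Proof. by move=> s t a x y; rewrite scaler0 addr0. Qed.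

Lemma multilinearD phi psi : multilinear phi -> multilinear psi ->
  multilinear (fun ws => phi ws + psi ws).
Proof. by move=> h h' s t a x y; rewrite h h' scalerDr addrACA. Qed.

Lemma multilinearN phi : multilinear phi -> multilinear (fun ws => - phi ws).
Proof. by move=> h s t a x y; rewrite h opprD scalerN. Qed.

Lemma multilinear_if (P : pred nat) phi psi : multilinear phi -> multilinear psi ->
  multilinear (fun ws => if P (size ws) then phi ws else psi ws).
Proof.
by move=> h h' s t a x y; rewrite !size_cat /=; case: ifP => _; [exact: h | exact: h'].
Qed.

Lemma multilinear_ssum (G : seq V -> seq V -> W) :
  (forall v, multilinear (G^~ v)) -> (forall u, multilinear (G u)) ->
  multilinear (ssum G).
Proof.
move=> h1 h2 s; elim: s G h1 h2 => [|y s IH] G h1 h2 t a u v; rewrite !ssum_cons.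
  rewrite (h2 [::] [::]) scalerDr addrACA; congr (_ + _).
  have := @ssum_linear _ _ _ _ (fun u v x => G (x :: u) v) t.
  by apply=> u' v'; exact: (h1 _ [::]).
rewrite (h2 [::] (y :: s)) scalerDr addrACA; congr (_ + _).
by apply: IH => [w|w]; [exact: (multilinear_cons _ (h1 w)) | exact: h2].
Qed.

Lemma multilinear_psum (G : seq V -> seq V -> W) :
  (forall v, multilinear (G^~ v)) -> (forall u, multilinear (G u)) ->
  multilinear (psum G).
Proof.
move=> h1 h2 [|x s] t a u v /=; rewrite !psum_cons; last first.
  by apply: multilinear_ssum => w; [exact: (multilinear_cons _ (h1 w)) | exact: h2].
have := @ssum_linear _ _ _ _ (fun u v x => G (x :: u) v) t.
by apply=> u' v'; exact: (h1 _ [::]).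
Qed.

(** Letters are decomposed into homogeneous parts one at a time, from the left; [zs] is the suffix
    still to be treated. This carries identities from tagged homogeneous words to all words. *)
Lemma multilinear_eq phi psi xs : multilinear phi -> multilinear psi ->
  (forall ys : seq (int * V), homog_seq ys -> size ys = size xs ->
     phi (elts ys) = psi (elts ys)) -> phi xs = psi xs.
Proof.
move=> h h' e; suff H : forall zs (ys : seq (int * V)), homog_seq ys ->
    (size ys + size zs)%N = size xs -> phi (elts ys ++ zs) = psi (elts ys ++ zs).
  exact: (H xs [::]).
elim=> [|x zs IH] ys hys sz; first by rewrite !cats0 e // -sz addn0.
have [s [c [_ hc ->]]] := homog_span x.
rewrite (lin_sum (h _ _)) (lin_sum (h' _ _)); apply: eq_bigr => i _.
have := IH (rcons ys (i, c i)); rewrite /elts map_rcons !cat_rcons; apply.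
  by move=> p; rewrite mem_rcons inE => /predU1P[->|/hys].
by rewrite size_rcons addSn -sz addnS.
Qed.

End Multilinear.

Section Insertion.
Variables (k : fieldType) (V : gradedSpace k).
Implicit Types (b : seq V -> V).

(* [phi] precomposed with the coderivation induced by [b]. *)
Definition ins (W : gradedSpace k) b (phi : seq V -> W) xs : W :=
  ssum (fun u w => psum (fun v t => phi (map tau u ++ b v :: t)) w) xs.

(** The projection of the tensor coalgebra onto its letters, which is the identity morphism read on
    the suspension. *)
Definition eta (xs : seq V) : V := if xs is [:: x] then x else 0.

Lemma multilinear_eta : multilinear eta.
Proof.
move=> s t a x y; case: s => [|z s].
  by case: t => [|z t] //=; rewrite scaler0 addr0.
by case: s => [|z' s] /=; rewrite scaler0 addr0.
Qed.

Variable W : gradedSpace k.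
Implicit Types (phi psi : seq V -> W).

Lemma ins_nil b phi : ins b phi [::] = 0.
Proof. by rewrite /ins ssum_nil psum_nil. Qed.

Lemma multilinear_ins b phi : multilinear b -> multilinear phi ->
  multilinear (ins b phi).
Proof.
move=> hb hphi; apply: multilinear_ssum => [w|u].
  move=> s t; apply: psum_linear => v t'.
  exact: (multilinear_map tau (multilinear_catr _ hphi)).
apply: multilinear_psum => [w s t a x y|w].
  by rewrite hb; exact: hphi.
have := multilinear_catl (map tau u ++ [:: b w]) hphi.
by move=> h s t a x y; have := h s t a x y; rewrite -!catA.
Qed.

Lemma insD b phi psi xs :
  ins b (fun ws => phi ws + psi ws) xs = ins b phi xs + ins b psi xs.
Proof.
by rewrite /ins -ssumD; apply: eq_ssum => u v _; rewrite -psumD.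
Qed.

Lemma ins_lin (U : gradedSpace k) (L : W -> U) b phi xs : linear L ->
  L (ins b phi xs) = ins b (fun ws => L (phi ws)) xs.
Proof.
move=> hL; rewrite (ssum_lin _ _ hL); apply: eq_ssum => u v _.
by rewrite (psum_lin _ _ hL).
Qed.

Lemma insN b phi xs : ins b (fun ws => - phi ws) xs = - ins b phi xs.
Proof.
rewrite (@ins_lin W -%R) // => a x y.
by rewrite opprD scalerN.
Qed.

Lemma eq_ins b b' phi phi' xs : (forall v, v != [::] -> b v = b' v) ->
  (forall ws, (0 < size ws <= size xs)%N -> phi ws = phi' ws) ->
  ins b phi xs = ins b' phi' xs.
Proof.
move=> hb hphi; apply: eq_ssum => u w e; apply: eq_psum => v t e' v0.
rewrite hb //; apply: hphi; rewrite size_cat size_map /= addnS ltnS leq0n /=.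
by rewrite -e -e' !size_cat; case: v v0 {e'} => //= x v _; lia.
Qed.

(** A coderivation is recovered from its projection to letters: only an insertion on the whole word
    leaves a single letter. *)
Lemma ins_eta b xs : xs != [::] -> ins b eta xs = b xs.
Proof.
move=> xs0; rewrite /ins ssumE [X in _ + X]psum_eq0 ?addr0; last first.
  move=> u w _ u0; apply: psum_eq0 => v t _ _.
  by case: u u0 => // x [].
rewrite psum_last // psum_eq0 ?add0r // => u v _ _.
by case: v.
Qed.

Lemma ins_tau b phi xs : (forall v, v != [::] -> b (map tau v) = - tau (b v)) ->
  multilinear phi ->
  ins b phi (map tau xs) = - ins b (fun ws => phi (map tau ws)) xs.
Proof.
move=> hb hphi; rewrite /ins ssum_map -ssumN; apply: eq_ssum => u w _.
rewrite psum_map -psumN; apply: eq_psum => v t _ v0.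
rewrite hb // (linN (hphi _ _)); congr (- phi _).
by rewrite map_cat.
Qed.

(** Two insertions are either nested, and then add up to insertions of [ins b b], or disjoint, and
    then cancel in pairs because [b] anticommutes with [tau]. *)
Lemma ins_ins b phi xs : (forall v, v != [::] -> b (map tau v) = - tau (b v)) ->
  (forall v, ins b b v = 0) -> multilinear phi -> ins b (ins b phi) xs = 0.
Proof.
move=> hb bb hphi.
(* Two disjoint insertions, on [m] and on [v]. The letters of [a], left of both, are hit by [tau]
   twice and so reappear unchanged. *)
pose P a m c v t := phi (a ++ tau (b m) :: map tau c ++ b v :: t).
pose I := ssum (fun a w => psum (fun m w' => ssum (fun c w'' =>
  psum (fun v t => P a m c v t) w'') w') w) xs.
(* The second insertion lies to the left of [b v], contains it, or lies to its right. *)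
have E u v t : ins b phi (map tau u ++ b v :: t) =
    - ssum (fun a w => psum (fun m c => P a m c v t) w) u
    + ssum (fun a c => ssum (fun e e' => phi (a ++ b (map tau c ++ b v :: e) :: e')) t) u
    + ssum (fun e w => psum (fun m e' => P u v e m e') w) t.
  rewrite [LHS]ssum_mid; congr (_ + _); last first.
    apply: eq_ssum => e w _; apply: eq_psum => m e' _ _.
    by rewrite map_cat map_tauK /P -catA.
  rewrite ssum_map -ssumN -ssumD; apply: eq_ssum => a w _.
  rewrite map_tauK psum_mid psum_map -psumN; congr (_ + _).
  apply: eq_psum => m c _ m0.
  by rewrite hb // (linN (hphi _ _)).
rewrite [LHS](eq_ssum (G' := fun u w =>
    - psum (fun v t => ssum (fun a w => psum (fun m c => P a m c v t) w) u) w +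
    psum (fun v t => ssum (fun a c => ssum (fun e e' =>
      phi (a ++ b (map tau c ++ b v :: e) :: e')) t) u) w +
    psum (fun v t => ssum (fun e w => psum (fun m e' => P u v e m e') w) t) w));
  last first.
  move=> u w _; rewrite -psumN -!psumD; apply: eq_psum => v t _ _; exact: E.
rewrite !ssumD ssumN -/I split_regroup [X in _ + X + _]ssum_eq0 ?addr0; last first.
  move=> a w _; apply: psum_eq0 => m e' _ _; rewrite -[RHS](multilinear0 a e' hphi).
  rewrite -(bb m) (ssum_lin _ _ (hphi a e')); apply: eq_ssum => c w' _.
  by rewrite (psum_lin _ _ (hphi a e')).
apply/eqP; rewrite addr_eq0 -/I; apply/eqP; congr (- _).
under eq_ssum => u w _.
  rewrite -ssum_psum_exchange; under eq_ssum do rewrite psum_exchange; over.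
rewrite ssumA; apply: eq_ssum => a w _; exact: ssum_psumA.
Qed.

End Insertion.

(** * Composition *)

Section CompositionLinear.
Variables (k : fieldType) (V W X : gradedSpace k).
Implicit Types (f : seq V -> W) (phi : seq W -> X).

Lemma pull_linear (Y : lmodType k) (F : seq W -> Y -> X) f xs :
  (forall ws, linear (F ws)) -> linear (fun y => pull f (F^~ y) xs).
Proof. by move=> h; apply: sum_linear => c; exact: h. Qed.

Lemma pull_lin (Y : lmodType k) (L : Y -> X) f (g : seq W -> Y) xs :
  linear L -> pull f (fun ws => L (g ws)) xs = L (pull f g xs).
Proof. by move=> hL; rewrite /pull (lin_sum hL). Qed.

Lemma multilinear_pull f phi : multilinear f -> multilinear phi ->
  multilinear (pull f phi).
Proof.
move=> hf hphi s t.
have -> : (fun x => pull f phi (s ++ x :: t)) = (fun x =>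
  ssum (fun u1 u2 => ssum (fun t1 t2 => pull f (fun a => pull f (fun c =>
    phi (a ++ f (u2 ++ x :: t1) :: c)) t2) u1) t) s).
  by apply: funext => x; exact: pull_mid.
apply: ssum_linear => u1 u2; apply: ssum_linear => t1 t2.
apply: (pull_linear (F := fun a x => pull f (fun c => phi (a ++ f (u2 ++ x :: t1) :: c)) t2)).
move=> a; apply: (pull_linear (F := fun c x => phi (a ++ f (u2 ++ x :: t1) :: c))).
by move=> c b x y; rewrite hf; exact: hphi.
Qed.

Lemma pull_map (U : gradedSpace k) (h : U -> V) f phi xs :
  pull f phi (map h xs) = pull (fun v => f (map h v)) phi xs.
Proof.
have [n] := ubnP (size xs); elim: n => // n IH in xs phi *; move=> sn.
have [->|xs0] := eqVneq xs [::]; first by rewrite !pull_nil.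
rewrite !pull_psum //; last by case: xs xs0 {sn}.
rewrite psum_map; apply: eq_psum => u v e u0; apply: IH.
by apply: leq_trans (size_psplit e u0) _; rewrite -ltnS.
Qed.

Lemma pull_mapr (h : W -> W) f phi xs :
  pull f (fun ws => phi (map h ws)) xs = pull (fun v => h (f v)) phi xs.
Proof. by rewrite /pull; apply: eq_bigr => c _; rewrite -map_comp. Qed.

Lemma pull_tau f phi xs : (forall v, v != [::] -> f (map tau v) = tau (f v)) ->
  pull f phi (map tau xs) = pull f (fun ws => phi (map tau ws)) xs.
Proof. move=> h; rewrite pull_map pull_mapr; apply: eq_pull => [u u0 _|//]; exact: h. Qed.

End CompositionLinear.

Section CompositionLaws.
Variables (k : fieldType) (V W X : gradedSpace k).
Implicit Types (f : seq V -> W) (g : seq W -> X).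

Lemma pull_etar f xs : xs != [::] -> pull f (@eta k W) xs = f xs.
Proof.
move=> xs0; rewrite pull_psum // psum_last // pull_nil psum_eq0 ?add0r //.
move=> u [|x v] // _ _; rewrite (eq_pull (f' := f) (phi' := fun=> 0)) //.
  exact: pull_eq0.
by case=> // _ /(_ isT).
Qed.

(** [eta] sends a block of two or more letters to 0, and a multilinear [g] vanishes on words
    containing 0. *)
Lemma pull_etal g xs : multilinear g -> pull (@eta k W) g xs = g xs.
Proof.
elim: xs g => [|x xs IH] g hg; first by rewrite pull_nil.
rewrite pull_psum // psum_cons ssumE IH; last exact: multilinear_cons.
rewrite psum_eq0 ?addr0 // => [[|y u]] v // _ _.
by apply: pull_eq0 => ws _; rewrite /eta (multilinear0 [::] _ hg).
Qed.

(** Associativity of composition: following the coalgebra morphism of [f] by that of [g] gives the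
    one induced by [pull f g]. *)
Lemma pull_comp (Y : gradedSpace k) f g (phi : seq X -> Y) xs : multilinear phi ->
  pull f (pull g phi) xs = pull (pull f g) phi xs.
Proof.
have [n] := ubnP (size xs); elim: n => // n IH in xs phi *; move=> sn hphi.
have [->|xs0] := eqVneq xs [::]; first by rewrite !pull_nil.
rewrite [LHS](eq_pull (f' := f)
    (phi' := psum (fun u w => pull g (fun ws => phi (g u :: ws)) w))) //; last first.
  by move=> ws _ /(_ xs0) ws0; rewrite pull_psum.
rewrite pull_psplit pull_psum //; apply: eq_psum => u v e u0.
have sv : (size v < n)%N by apply: leq_trans (size_psplit e u0) _; rewrite -ltnS.
rewrite (eq_pullr _ _ (fun a => IH _ _ sv (multilinear_cons (g a) hphi))).
apply: (@pull_lin _ V W Y X (fun y => pull (pull f g) (fun ws => phi (y :: ws)) v)).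
apply: (@pull_linear _ V X Y _ (fun ws y => phi (y :: ws))) => ws.
exact: (hphi [::]).
Qed.

End CompositionLaws.

Section CompositionInsertion.
Variables (k : fieldType) (V W X : gradedSpace k).
Variables (f : seq V -> W) (phi : seq W -> X).
Hypothesis hphi : multilinear phi.

(* [f (x) ... (x) D (x) ... (x) f], the coderivation along [f] defined by [D]. *)
Definition coder (D : seq V -> W) xs : X :=
  ssum (fun u w => psum (fun v z => pull f (fun a => pull f (fun t =>
    phi (map tau a ++ D v :: t)) z) u) w) xs.

Fact coder_linear u z :
  linear (fun y => pull f (fun a => pull f (fun t => phi (map tau a ++ y :: t)) z) u).
Proof.
apply: (pull_linear (F := fun a y => pull f (fun t => phi (map tau a ++ y :: t)) z)).
move=> a; apply: (pull_linear (F := fun t y => phi (map tau a ++ y :: t))) => t.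
exact: hphi.
Qed.

(** Together with [ins_pull] this shows that both sides of the morphism equation extend to
    coderivations along [f]. Their difference is then the [coder] of the defect of [f]. *)
Lemma pull_ins (b : seq W -> W) xs : pull f (ins b phi) xs = coder (pull f b) xs.
Proof.
rewrite pull_split; apply: eq_ssum => u w _.
rewrite (eq_pullr _ _ (fun a => pull_psplit f
  (fun v t => phi (map tau a ++ b v :: t)) w)).
rewrite [LHS]exchange_big; apply: eq_bigr => -[v z] _ /=.
rewrite -(pull_lin _ _ _ (coder_linear u z)).
rewrite [LHS]exchange_big; apply: eq_bigr => c _.
by apply: eq_bigr.
Qed.

(** The block containing the inserted value defines a larger factor of the original word, hence
    [split_regroup]; the sign passes the blocks on its left because [f] commutes with [tau]. *)
Lemma ins_pull (b : seq V -> V) xs :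
  (forall v, v != [::] -> f (map tau v) = tau (f v)) ->
  ins b (pull f phi) xs = coder (ins b f) xs.
Proof.
move=> ftau; rewrite /ins.
under eq_ssum => u w _ do under eq_psum => v t _ _ do rewrite pull_mid ssum_map.
rewrite split_regroup; apply: eq_ssum => a w _; apply: eq_psum => m e' _ _.
rewrite (ssum_lin _ _ (coder_linear a e')); apply: eq_ssum => c w' _.
rewrite (psum_lin _ _ (coder_linear a e')); apply: eq_psum => v e _ _.
by rewrite pull_tau.
Qed.

Lemma coderB D D' xs :
  coder (fun v => D v - D' v) xs = coder D xs - coder D' xs.
Proof.
rewrite /coder -ssumN -ssumD; apply: eq_ssum => u w _.
rewrite -psumN -psumD; apply: eq_psum => v z _ _.
exact: (linB (coder_linear u z)).
Qed.

(** The leading term for obstruction arguments: a proper factor of [xs] is shorter than [xs], so [D]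
    can only act on the whole word. *)
Lemma coder_lead D xs : xs != [::] ->
  (forall v, v != [::] -> (size v < size xs)%N -> D v = 0) ->
  coder D xs = phi [:: D xs].
Proof.
move=> xs0 h; have z u v w e : u ++ v ++ w = xs -> v != [::] -> (u ++ w) != [::] ->
    pull f (fun a => pull f (fun t => phi (map tau a ++ D v :: t)) e) u = 0.
  move=> e1 v0 uw0; rewrite h //; first exact: (lin0 (coder_linear u e)).
  rewrite -e1 !size_cat addnCA -[X in (X < _)%N]addn0 ltn_add2l -size_cat.
  by case: (u ++ w) uw0.
rewrite /coder ssumE [X in _ + X]psum_eq0 ?addr0; last first.
  move=> u w e u0; apply: psum_eq0 => v t e' v0; apply: (z u v t) => //.
    by rewrite e'.
  by case: u u0 {e}.
rewrite psum_last // psum_eq0 ?add0r => [|v t e v0].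
  by rewrite !pull_nil.
by case: t e => // y t e; apply: (z [::] v (y :: t)).
Qed.

End CompositionInsertion.

(** * Degrees and the sign dictionary *)

Section ShiftedDegree.
Variables (k : fieldType).
Implicit Types (V W U X : gradedSpace k).

(* [phi] has degree [e] as a map out of the tensor algebra of the suspension. *)
Definition sdeg V W (e : int) (phi : seq V -> W) : Prop :=
  forall xs, homog_seq xs -> homog (degs xs + (size xs)%:Z + e) (phi (elts xs)).

Lemma homog_seq_cat V (u v : seq (int * V)) :
  homog_seq (u ++ v) <-> homog_seq u /\ homog_seq v.
Proof.
split=> [h|[hu hv] p]; last by rewrite mem_cat => /orP[/hu|/hv].
by split=> p hp; apply: h; rewrite mem_cat hp ?orbT.
Qed.

Lemma homog_seq_cons V (p : int * V) xs :
  homog_seq (p :: xs) <-> homog p.1 p.2 /\ homog_seq xs.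
Proof.
split=> [h|[hp hxs] q]; last by rewrite inE => /predU1P[->|/hxs].
by split=> [|q hq]; apply: h; rewrite inE ?eqxx // hq orbT.
Qed.

Lemma degs_cat V (u v : seq (int * V)) : degs (u ++ v) = degs u + degs v.
Proof. exact: big_cat. Qed.

Lemma degs_cons V p (xs : seq (int * V)) : degs (p :: xs) = p.1 + degs xs.
Proof. exact: big_cons. Qed.

Lemma elts_cat V (u v : seq (int * V)) : elts (u ++ v) = elts u ++ elts v.
Proof. exact: map_cat. Qed.

Lemma homog_degE V i j (x : V) : homog i x -> i = j -> homog j x.
Proof. by move=> h <-. Qed.

Lemma sdeg_ssum V W e (G : seq V -> seq V -> W) xs : homog_seq xs ->
  (forall u v, u ++ v = xs -> homog_seq u -> homog_seq v ->
     homog e (G (elts u) (elts v))) ->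
  homog e (ssum G (elts xs)).
Proof.
move=> hxs h; rewrite ssum_map.
elim: xs hxs G h => [|p xs IH] hxs G h.
  by rewrite ssum_nil; exact: (h [::] [::]).
rewrite ssum_cons; apply: homogD; first exact: (h [::] (p :: xs)).
have [hp hxs'] := (homog_seq_cons p xs).1 hxs.
apply: (IH hxs' (fun u => G (p.2 :: u))) => u v e1 hu hv.
by apply: (h (p :: u)) => //=; [rewrite e1 | apply/homog_seq_cons].
Qed.

Lemma sdeg_psum V W e (G : seq V -> seq V -> W) xs : homog_seq xs ->
  (forall u v, u ++ v = xs -> homog_seq u -> homog_seq v -> u != [::] ->
     homog e (G (elts u) (elts v))) ->
  homog e (psum G (elts xs)).
Proof.
case: xs => [|p xs] hxs h; first by rewrite psum_nil; exact: homog0.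
have [hp hxs'] := (homog_seq_cons p xs).1 hxs.
rewrite psum_cons; apply: (sdeg_ssum hxs') => u v e1 hu hv.
by apply: (h (p :: u)) => //=; [rewrite e1 | apply/homog_seq_cons].
Qed.

Definition tag_tau V (xs : seq (int * V)) := [seq (p.1, tau p.2) | p <- xs].

Lemma elts_tau V (xs : seq (int * V)) : elts (tag_tau xs) = map tau (elts xs).
Proof. by rewrite /elts -!map_comp. Qed.

Lemma degs_tau V (xs : seq (int * V)) : degs (tag_tau xs) = degs xs.
Proof. by rewrite /degs big_map. Qed.

Lemma homog_seq_tau V (xs : seq (int * V)) : homog_seq xs -> homog_seq (tag_tau xs).
Proof. by move=> h p /mapP[q /h hq ->]; exact: tau_homog. Qed.

Lemma sdeg_cons V W e i (x : V) (phi : seq V -> W) : homog i x -> sdeg e phi ->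
  sdeg (e + (i + 1)) (fun ws => phi (x :: ws)).
Proof.
move=> hx hphi xs hxs; have := hphi ((i, x) :: xs).
rewrite degs_cons /= => h; apply: homog_degE (h _) _; last lia.
exact/homog_seq_cons.
Qed.

Lemma sdeg_zero V W e : sdeg e (fun _ : seq V => 0 : W).
Proof. by move=> xs _; exact: homog0. Qed.

Lemma sdegD V W e (phi psi : seq V -> W) : sdeg e phi -> sdeg e psi ->
  sdeg e (fun ws => phi ws + psi ws).
Proof. by move=> h h' xs hxs; apply: homogD; [exact: h | exact: h']. Qed.

Lemma sdegN V W e (phi : seq V -> W) : sdeg e phi -> sdeg e (fun ws => - phi ws).
Proof. by move=> h xs hxs; apply: homogN; exact: h. Qed.

Lemma sdeg_if V W e (P : pred nat) (phi psi : seq V -> W) : sdeg e phi -> sdeg e psi ->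
  sdeg e (fun ws => if P (size ws) then phi ws else psi ws).
Proof. by move=> h h' xs hxs; case: ifP => _; [exact: h | exact: h']. Qed.

Lemma sdeg_lin V W U e j (L : W -> U) (phi : seq V -> W) :
  (forall i x, homog i x -> homog (i + j) (L x)) -> sdeg e phi ->
  sdeg (e + j) (fun ws => L (phi ws)).
Proof. by move=> hL h xs hxs; rewrite addrA; apply/hL/h. Qed.

Lemma sdeg_maptau V W e (phi : seq V -> W) : sdeg e phi ->
  sdeg e (fun ws => phi (map tau ws)).
Proof.
move=> h xs hxs; rewrite -elts_tau.
by apply: homog_degE (h _ (homog_seq_tau hxs)) _; rewrite degs_tau size_map.
Qed.

Lemma sdeg_eta V : sdeg (-1) (@eta k V).
Proof.
case=> [|[i x] [|[j y] xs]] h; try exact: homog0.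
rewrite /degs big_seq1 /= addrK; apply: (h (i, x)); exact: mem_head.
Qed.

Lemma sdeg_ins V W e b (phi : seq V -> W) : sdeg (-2) b -> sdeg e phi ->
  sdeg (e - 1) (ins b phi).
Proof.
move=> hb hphi xs hxs; apply: sdeg_ssum => // u w eu hu hw.
apply: sdeg_psum => // v t ev hv ht _.
have := hphi (tag_tau u ++ (degs v + (size v)%:Z - 2, b (elts v)) :: t).
rewrite !elts_cat elts_tau => h; apply: homog_degE (h _) _.
  apply/homog_seq_cat; split; first exact: homog_seq_tau.
  by apply/homog_seq_cons; split => //; exact: hb.
rewrite -eu -ev !degs_cat degs_tau degs_cons !size_cat size_map /=; lia.
Qed.

Lemma sdeg_pull V W X e (f : seq V -> W) (phi : seq W -> X) : sdeg (-1) f ->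
  sdeg e phi -> sdeg e (pull f phi).
Proof.
move=> hf hphi xs; have [n] := ubnP (size xs).
elim: n => // n IH in xs e phi hphi *; move=> sn hxs.
have [xs0|xs0] := eqVneq (elts xs) [::].
  rewrite xs0 pull_nil; case: xs xs0 {sn hxs} => // _.
  by apply: homog_degE (hphi [::] _) _ => //; rewrite /degs !big_nil.
rewrite pull_psum //; apply: (sdeg_psum hxs) => u v euv hu hv u0.
have := IH v _ _ (sdeg_cons (hf _ hu) hphi) _ hv.
move=> h; apply: homog_degE (h _) _.
  by apply: leq_trans (size_psplit euv u0) _; rewrite -ltnS.
rewrite -euv degs_cat size_cat; lia.
Qed.

Lemma multilinear_tau V W (phi : seq V -> W) s xs : multilinear phi -> homog_seq xs ->
  phi (s ++ map tau (elts xs)) =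
  (-1 : k) ^ (degs xs + (size xs)%:Z) *: phi (s ++ elts xs).
Proof.
move=> hphi; elim: xs s => [|[i x] xs IH] s hxs.
  by rewrite /degs big_nil expr0z scale1r.
have [/= hx hxs'] := (homog_seq_cons (i, x) xs).1 hxs.
rewrite [elts _]/= [map _ _]/= (tauE hx) (linZ (hphi _ _)).
have := IH (rcons s x) hxs'; rewrite !cat_rcons => ->; rewrite scalerA degs_cons.
rewrite -signzD; congr (_ ^ _ *: _); rewrite /=; lia.
Qed.

(** The exponent is [e + 1] and not [e] because [sdeg] does not suspend the target, whereas [tau] on
    the target counts the suspended degree. *)
Lemma sdeg_tau V W e (phi : seq V -> W) xs : multilinear phi -> sdeg e phi ->
  phi (map tau xs) = (-1 : k) ^ (e + 1) *: tau (phi xs).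
Proof.
move=> hphi dphi.
apply: (multilinear_eq (phi := fun xs => phi (map tau xs))
  (psi := fun xs => (-1) ^ (e + 1) *: tau (phi xs))).
- exact: multilinear_map.
- apply: (multilinear_lin (L := fun y : W => (-1) ^ (e + 1) *: tau y)) => // a x y.
  by rewrite linearP scalerDr !scalerA mulrC.
move=> ys hys _; rewrite (multilinear_tau [::] hphi hys) (tauE (dphi _ hys)).
rewrite scalerA -signzD; congr (_ *: _); apply: signz_eq; lia.
Qed.

Lemma sdeg_tauN1 V W (phi : seq V -> W) xs : multilinear phi -> sdeg (-1) phi ->
  phi (map tau xs) = tau (phi xs).
Proof. by move=> h h'; rewrite (sdeg_tau _ h h') addNr expr0z scale1r. Qed.

Lemma sdeg_tauN2 V (b : seq V -> V) xs : multilinear b -> sdeg (-2) b ->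
  b (map tau xs) = - tau (b xs).
Proof.
by move=> h h'; rewrite (sdeg_tau _ h h') -[RHS]scaleN1r signz_odd.
Qed.

Lemma sdeg_tau0 V W (g : seq V -> W) xs : multilinear g -> sdeg 0 g ->
  g (map tau xs) = - tau (g xs).
Proof. by move=> h h'; rewrite (sdeg_tau _ h h') -[RHS]scaleN1r. Qed.

End ShiftedDegree.

(** * Change of variables to the suspension, and its signs *)

Section Bar.
Variables (k : fieldType).
Implicit Types (V W X : gradedSpace k).

(** Each letter receives one [tau] for every letter to its right. On homogeneous words this is the
    decalage sign, with exponent [bar_exp]. *)
Fixpoint twist V (xs : seq V) : seq V :=
  if xs is x :: xs' then iter (size xs') tau x :: twist xs' else [::].

(* The family f read on the suspension; the signs of the [A_infinity] relations
   are exactly those absorbed by this change of variables. *)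
Definition bar V W (f : seq V -> W) (xs : seq V) : W :=
  if xs is [::] then 0 else f (twist xs).

Fixpoint bar_exp V (xs : seq (int * V)) : int :=
  if xs is p :: xs' then (p.1 + 1) * (size xs')%:Z + bar_exp xs' else 0.

Lemma bar_nil V W (f : seq V -> W) : bar f [::] = 0.
Proof. by []. Qed.

Lemma size_twist V (xs : seq V) : size (twist xs) = size xs.
Proof. by elim: xs => //= x xs ->. Qed.

Lemma twistK V (xs : seq V) : twist (twist xs) = xs.
Proof.
elim: xs => //= x xs ->; rewrite size_twist; congr (_ :: _).
by elim: (size xs) => //= n; rewrite -iterS iterSr tauK.
Qed.

Lemma barK V W (f : seq V -> W) xs : xs != [::] -> bar (bar f) xs = f xs.
Proof. by case: xs => // x xs _; rewrite -[in RHS](twistK (x :: xs)). Qed.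

Lemma twist_cat V (s t : seq V) :
  twist (s ++ t) = map (iter (size t) tau) (twist s) ++ twist t.
Proof.
by elim: s => //= x s ->; rewrite size_cat addnC iterD.
Qed.

Lemma multilinear_bar V W (f : seq V -> W) : multilinear f -> multilinear (bar f).
Proof.
move=> hf s t.
have -> : (fun x => bar f (s ++ x :: t)) = (fun x => f
    (map (iter (size t).+1 tau) (twist s) ++ iter (size t) tau x :: twist t)).
  apply: funext => x; case: s => [//|y s].
  by rewrite -[LHS]/(f (twist ((y :: s) ++ x :: t))) twist_cat.
have hi n a (x y : V) : iter n tau (a *: x + y) = a *: iter n tau x + iter n tau y.
  by elim: n => //= n ->; rewrite linearP.
by move=> a x y; rewrite hi; exact: hf.
Qed.

Lemma iter_tau V n i (x : V) : homog i x ->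
  iter n tau x = (-1 : k) ^ ((i + 1) * n%:Z) *: x.
Proof.
move=> hx; elim: n => [|n IH]; first by rewrite mulr0 expr0z scale1r.
rewrite iterS IH linearZ /= (tauE hx) scalerA -signzD.
by rewrite -[in RHS]addn1 PoszD mulrDr mulr1.
Qed.

Lemma multilinear_twist V W (f : seq V -> W) s xs : multilinear f -> homog_seq xs ->
  f (s ++ twist (elts xs)) = (-1 : k) ^ bar_exp xs *: f (s ++ elts xs).
Proof.
move=> hf; elim: xs s => [|[i x] xs IH] s hxs; first by rewrite expr0z scale1r.
have [/= hx hxs'] := (homog_seq_cons (i, x) xs).1 hxs.
rewrite size_map (iter_tau _ hx) (linZ (hf _ _)).
by have := IH (rcons s x) hxs'; rewrite !cat_rcons => ->; rewrite scalerA -signzD.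
Qed.

Lemma bar_elts V W (f : seq V -> W) xs : multilinear f -> homog_seq xs ->
  xs != [::] -> bar f (elts xs) = (-1 : k) ^ bar_exp xs *: f (elts xs).
Proof.
by move=> hf hxs xs0; rewrite -(multilinear_twist [::] hf hxs); case: xs xs0 {hxs}.
Qed.

Lemma bar_exp_cat V (u v : seq (int * V)) : bar_exp (u ++ v) =
  (degs u + (size u)%:Z) * (size v)%:Z + bar_exp u + bar_exp v.
Proof.
elim: u => [|p u IH] /=; first by rewrite /degs big_nil mul0r !add0r.
rewrite IH size_cat degs_cons; lia.
Qed.

Lemma sdeg_bar V W e (f : seq V -> W) : multilinear f ->
  family_degree (fun n => n%:Z + e) f -> sdeg e (bar f).
Proof.
move=> hf df xs hxs; have [->|xs0] := eqVneq xs [::]; first exact: homog0.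
rewrite bar_elts //; apply: homogZ; rewrite -addrA; apply: df => //.
by case: xs xs0 {hxs}.
Qed.

Lemma family_degree_bar V W e (f : seq V -> W) : multilinear f -> sdeg e f ->
  family_degree (fun n => n%:Z + e) (bar f).
Proof.
move=> hf df xs hxs xs0; rewrite bar_elts //; last by case: xs xs0 {hxs}.
by apply: homogZ; rewrite addrA; apply: df.
Qed.

(** The sign in front depends on the word alone, so an identity between such sums can be tested on
    either side of the dictionary. *)
Lemma insert_sumE V W (f : seq V -> W) (m : seq V -> V) xs :
  multilinear f -> multilinear m -> family_degree (fun n => n%:Z - 2) m ->
  homog_seq xs ->
  insert_sum f m xs = (-1 : k) ^ bar_exp xs *: ins (bar m) (bar f) (elts xs).
Proof.
move=> hf hm dm hxs.
have E u v t : u ++ v ++ t = xs -> v != [::] ->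
    (-1 : k) ^+ (size u * size v + size t) *:
      ((-1) ^ (((size v)%:Z - 2) * degs u) *: f (elts u ++ m (elts v) :: elts t)) =
    (-1) ^ bar_exp xs *: bar f (map tau (elts u) ++ bar m (elts v) :: elts t).
  move=> exs v0; move: hxs; rewrite -exs => /homog_seq_cat[hu /homog_seq_cat[hv ht]].
  rewrite (bar_elts hm hv v0) (linZ (multilinear_bar hf _ _)).
  have hfb := multilinear_catr (m (elts v) :: elts t) (multilinear_bar hf).
  rewrite (multilinear_tau [::] hfb hu).
  pose y := (degs v + ((size v)%:Z - 2), m (elts v)).
  have hy : homog_seq (u ++ y :: t).
    apply/homog_seq_cat; split => //; apply/homog_seq_cons; split => //.
    by apply: dm => //; rewrite lt0n size_eq0.
  have := bar_elts hf hy; rewrite elts_cat /= => -> //; last by case: (u).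
  rewrite !scalerA exprnP -!signzD; congr (_ *: _); apply: signz_eq.
  rewrite !bar_exp_cat /= !size_cat /=.
  (* Only the eight parities matter, and all their combinations are checked. *)
  move: (degs u) (degs v) (bar_exp u) (bar_exp v) (bar_exp t) => a b c d e.
  move: (size u) (size v) (size t) => r s n.
  rewrite PoszD PoszM !(odd_abszD, odd_abszM, abszN) /= oddD.
  case: (odd `|a|); case: (odd `|b|); case: (odd `|c|); case: (odd `|d|);
  case: (odd `|e|); case: (odd r); case: (odd s); case: (odd n) => //=.
rewrite /ins ssum_map ssumE_nat big_nat_recr //= drop_size psum_nil addr0.
rewrite scaler_sumr; apply: eq_big_nat => r /andP[_ rn].
rewrite psum_map psumE_nat size_drop scaler_sumr; apply: eq_big_nat => s /andP[s1 sn].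
have sz : size (take s (drop r xs)) = s.
  by rewrite size_takel // size_drop; lia.
rewrite drop_drop -(E _ (take s (drop r xs))); last 2 first.
- by rewrite -drop_drop !cat_take_drop.
- by rewrite -size_eq0 sz; lia.
by rewrite sz size_take rn size_drop /insert_at [(s + r)%N]addnC subnDA.
Qed.

(** The lists of block lengths, enumerated in parallel with [cuts]; [sum_comps] matches them with
    the bounded tuples that index [blockwise_sum]. *)
Fixpoint comps (n : nat) : seq (seq nat) :=
  if n is n'.+1 then
    if n' is 0%N then [:: [:: 1%N]] else
    [seq 1%N :: c | c <- comps n'] ++
    [seq (head 0%N c).+1 :: behead c | c <- comps n']
  else [:: [::]].

Lemma compsSS n : comps n.+2 = [seq 1%N :: c | c <- comps n.+1] ++
    [seq (head 0%N c).+1 :: behead c | c <- comps n.+1].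
Proof. by []. Qed.

Lemma cuts_cons2 (T : Type) (x y : T) xs : cuts (x :: y :: xs) =
  [seq [:: x] :: c | c <- cuts (y :: xs)] ++
  [seq (x :: head [::] c) :: behead c | c <- cuts (y :: xs)].
Proof. by []. Qed.

Lemma cuts_comps (T : Type) (xs : seq T) :
  cuts xs = [seq reshape c xs | c <- comps (size xs)].
Proof.
elim: xs => [|x [|y xs] IH] //.
rewrite cuts_cons2 IH [size (x :: _)]/= compsSS map_cat -!map_comp; congr (_ ++ _).
by apply: eq_map => -[|c0 c].
Qed.

Lemma comps_mem n c : (c \in comps n) = is_composition n c.
Proof.
elim: n c => [|[|n] IH] c.
- by case: c => [|[|c0] c] //=; rewrite inE /is_composition /= addSn andbF.
- case: c => [|[|[|c0]] c] //; rewrite inE /is_composition /=.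
  + by case: c => [|[|c1] c] //=; rewrite ?andbF // addnS andbF.
  + by rewrite !addSn andbF.
rewrite compsSS mem_cat; apply/orP/idP => [[/mapP[c']|/mapP[c']]|].
- by rewrite IH => /andP[a e] ->; rewrite /is_composition /= a /= eqSS in e *.
- rewrite IH => /andP[]; case: c' => [|c0 c'] //= /andP[_ a] e ->.
  by rewrite /is_composition /= a addSn eqSS.
case: c => [|[|[|c0]] c] // /andP[/= a e].
- left; apply/mapP; exists c => //; rewrite IH /is_composition a.
  by rewrite add1n eqSS in e.
right; apply/mapP; exists (c0.+1 :: c) => //.
by rewrite IH /is_composition /= a; rewrite addSn eqSS in e.
Qed.

Lemma comps_uniq n : uniq (comps n).
Proof.
elim: n => [|[|n] IH] //; rewrite compsSS cat_uniq !map_inj_in_uniq ?IH ?andbT //.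
- apply/hasPn => _ /mapP[c cin ->]; apply/mapP => -[c' _].
  by move: cin; rewrite comps_mem; case: c => [|[|c0] c].
- move=> c c'; rewrite !comps_mem.
  by case: c => [|c0 c]; case: c' => [|c0' c'] // _ _ /= [-> ->].
- by move=> c c' _ _ [].
Qed.

Lemma sum_comps (X : zmodType) n (F : seq nat -> X) : (0 < n)%N ->
  \sum_(1 <= r < n.+1) \sum_(c : r.-tuple 'I_n.+1 | is_composition n (map val c))
     F (map val c) = \sum_(c <- comps n) F c.
Proof.
move=> n0.
have size_comp c : c \in comps n -> (1 <= size c < n.+1)%N.
  rewrite comps_mem => /andP[a /eqP e]; rewrite ltnS -e; apply/andP; split.
    by case: c {a} e => // e; rewrite -e in n0.
  elim: c a {e} => //= c0 c IH /andP[c1 /IH]; lia.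
transitivity (\sum_(1 <= r < n.+1) \sum_(c <- comps n | size c == r) F c); last first.
  rewrite (exchange_big_dep xpredT) //= big_seq [RHS]big_seq; apply: eq_bigr => c cin.
  rewrite -big_filter (perm_big [:: size c]) ?big_seq1 //.
  apply: uniq_perm => //; first exact/filter_uniq/iota_uniq.
  move=> r; rewrite mem_filter mem_index_iota inE eq_sym.
  by case: eqP => // ->; exact: size_comp.
apply: eq_big_nat => r _.
rewrite -big_filter -[RHS]big_filter.
rewrite -(big_map (fun c : r.-tuple 'I_n.+1 => map val c) xpredT F).
apply: perm_big; apply: uniq_perm.
- rewrite map_inj_uniq; first exact/filter_uniq/index_enum_uniq.
  by move=> c c' /(inj_map val_inj)/val_inj.
- exact/filter_uniq/comps_uniq.
move=> c; rewrite mem_filter comps_mem; apply/mapP/andP => [[t]|[/eqP sz hc]].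
  by rewrite mem_filter => /andP[h _] ->; rewrite size_map size_tuple eqxx.
have lec i : i \in c -> (i < n.+1)%N.
  move=> ic; rewrite ltnS; have /andP[_ /eqP<-] := hc.
  by elim: c ic {sz hc} => //= c0 c IH; rewrite inE => /predU1P[->|/IH]; lia.
pose t := [seq inord i : 'I_n.+1 | i <- c].
have tsz : size t == r by rewrite size_map sz.
have te : map val t = c.
  rewrite -map_comp -[RHS]map_id; apply/eq_in_map => i ic /=.
  by rewrite inordK // lec.
exists (Tuple tsz); rewrite ?te // mem_filter mem_index_enum /= te hc.
by [].
Qed.

(** [comp_exponent] and the Koszul exponent of [blockwise] in one: the component applied to block q
    has degree [i_q - 1], and the earlier block p counts with its suspended degree. *)
Definition block_exp V (bs : seq (seq (int * V))) : int :=
  \sum_(q < size bs) \sum_(p < q) ((size (nth [::] bs q))%:Z - 1) *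
    (degs (nth [::] bs p) + (size (nth [::] bs p))%:Z).

Lemma block_exp_cons V (b : seq (int * V)) bs : block_exp (b :: bs) =
  (degs b + (size b)%:Z) * ((size (flatten bs))%:Z - (size bs)%:Z) + block_exp bs.
Proof.
rewrite /block_exp [size (b :: bs)]/= big_ord_recl big_ord0 add0r.
under eq_bigr do rewrite big_ord_recl.
rewrite big_split /= -mulr_suml mulrC; congr (_ * _ + _).
rewrite size_flatten; elim: bs => [|c bs IH]; first by rewrite big_ord0.
by rewrite /= big_ord_recl IH PoszD /=; lia.
Qed.

Lemma blockwise_expE V c (xs : seq (int * V)) : is_composition (size xs) c ->
  (-1 : k) ^+ comp_exponent c * (-1) ^ (\sum_(q < size c) \sum_(p < q)
     ((nth 0%N c q)%:Z - 1) * degs (nth [::] (reshape c xs) p)) =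
  (-1) ^ block_exp (reshape c xs).
Proof.
move=> /andP[/all_nthP c1 /eqP sc]; rewrite exprnP -signzD; congr (_ ^ _).
have sh : shape (reshape c xs) = c by rewrite reshapeKl // sc.
have sr : size (reshape c xs) = size c by rewrite size_reshape.
rewrite /comp_exponent /block_exp sr -!natz !natr_sum -big_split /=.
apply: eq_bigr => q _; rewrite natr_sum -big_split /=; apply: eq_bigr => p _.
have sz j : (j < size c)%N -> size (nth [::] (reshape c xs) j) = nth 0%N c j.
  by move=> jc; rewrite -[in RHS]sh (nth_map [::]) // sr.
rewrite !sz ?(ltn_trans (ltn_ord p)) // mulrDr addrC; congr (_ + _).
by rewrite natz PoszM -subzn // c1.
Qed.

(** Modulo 2, [bar_exp] of the concatenated word is [block_exp], plus the exponents inside the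
    blocks, plus the exponent of the word of values. This is checked by peeling off one block at a
    time. *)
Lemma blockwiseE V W X (g : seq W -> X) (f : seq V -> W) (bs : seq (seq (int * V))) :
  multilinear g -> multilinear f -> family_degree (fun n => n%:Z - 1) f ->
  (forall b, b \in bs -> homog_seq b /\ b != [::]) -> bs != [::] ->
  (-1 : k) ^ block_exp bs *: g [seq f (elts b) | b <- bs] =
  (-1) ^ bar_exp (flatten bs) *: bar g [seq bar f (elts b) | b <- bs].
Proof.
move=> hg hf df hbs bs0.
pose tg b := (degs b + ((size b)%:Z - 1), f (elts b)).
have htg : homog_seq (map tg bs).
  move=> _ /mapP[b bbs ->]; have [hb b0] := hbs _ bbs.
  by apply: df => //; rewrite lt0n size_eq0.
have E1 s : bar g (s ++ [seq bar f (elts b) | b <- bs]) =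
    (-1) ^ (\sum_(b <- bs) bar_exp b) *: bar g (s ++ [seq f (elts b) | b <- bs]).
  elim: bs s hbs {bs0 htg} => [|b bs IH] s hbs; first by rewrite big_nil expr0z scale1r.
  have [hb b0] := hbs b (mem_head _ _).
  rewrite big_cons [map _ _]/= (bar_elts hf hb b0) (linZ (multilinear_bar hg _ _)).
  have := IH (rcons s (f (elts b))) _.
  rewrite !cat_rcons => -> => [|c cbs]; last by apply: hbs; rewrite inE cbs orbT.
  by rewrite scalerA -signzD.
rewrite (E1 [::]) /=.
have -> : [seq f (elts b) | b <- bs] = elts (map tg bs) by rewrite /elts -map_comp.
rewrite (bar_elts hg htg); last by case: (bs) bs0.
rewrite !scalerA -!signzD; congr (_ *: _).
elim: bs {hbs bs0 htg E1} => [|b bs IH].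
  by rewrite /block_exp /= big_nil !big_ord0.
rewrite block_exp_cons /= bar_exp_cat big_cons size_map.
set S := \sum_(b <- bs) _ in IH *; set E := bar_exp (map _ _) in IH *.
have -> : (degs b + ((size b)%:Z - 1) + 1) = degs b + (size b)%:Z by lia.
rewrite !signzD in IH *; rewrite IH; move: (signz_sqr k (bar_exp b)).
rewrite mulrBr signzD => e.
have -> : (-1 : k) ^ (- ((degs b + (size b)%:Z) * (size bs)%:Z)) =
    (-1) ^ ((degs b + (size b)%:Z) * (size bs)%:Z) by apply: signz_eq; rewrite abszN.
by rewrite -[LHS]mulr1 -[X in _ * X = _]e; ring.
Qed.

Lemma blockwise_sumE V W X (g : seq W -> X) (f : seq V -> W) (xs : seq (int * V)) :
  multilinear g -> multilinear f -> family_degree (fun n => n%:Z - 1) f ->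
  homog_seq xs -> (0 < size xs)%N ->
  blockwise_sum g f xs = (-1) ^ bar_exp xs *: pull (bar f) (bar g) (elts xs).
Proof.
move=> hg hf df hxs xs0.
rewrite /blockwise_sum
  (sum_comps (fun c => (-1) ^+ comp_exponent c *: blockwise g f c xs)) //.
rewrite /pull cuts_comps big_map size_map scaler_sumr.
rewrite big_seq [RHS]big_seq; apply: eq_bigr => c; rewrite comps_mem => cn.
rewrite /blockwise scalerA blockwise_expE //.
have sc : sumn c = size xs by case/andP: cn => _ /eqP.
have fl : flatten (reshape c xs) = xs by rewrite reshapeKr // sc.
rewrite (blockwiseE (bs := reshape c xs) hg hf df) ?fl //; first 1 last.
- move=> b /(nthP [::])[j]; rewrite size_reshape => jc <-; split.
    move=> p pb; apply: hxs; rewrite -fl; apply/flattenP.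
    by exists (nth [::] (reshape c xs) j) => //; apply: mem_nth; rewrite size_reshape.
  have sh : shape (reshape c xs) = c by rewrite reshapeKl // sc.
  rewrite -size_eq0 -(nth_map [::] 0%N (@size _)) ?size_reshape // -/(shape _) sh.
  by case/andP: cn => /all_nthP c1 _; rewrite -lt0n; apply: c1.
- by rewrite -size_eq0 size_reshape; case: (c) sc => // sc; rewrite -sc in xs0.
congr (_ *: bar g _); rewrite /elts; elim: c xs {hxs xs0 cn sc fl} => //= n c IH xs.
by rewrite map_take -map_drop -IH.
Qed.

End Bar.

(** * Convolution with values in a dg-algebra *)

Section DgAlgebra.
Variables (k : fieldType) (A : dgAlgebra k).
Local Notation d := (@cx_d k A).
Local Notation mul := (@dga_mul k A).

(** The Leibniz rule with its sign written through [tau], which makes sense for inhomogeneous [x];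
    the suspension in [tau] accounts for the minus. *)
Lemma d_mul x y : d (mul x y) = mul (d x) y - mul (tau x) (d y).
Proof.
have mulL z : linear (mul^~ z) := dga_mul_linearl z.
have l1 : linear (fun x => d (mul x y)).
  by move=> a u v; rewrite (mulL y a) cx_d_linear.
have l2 : linear (fun x => mul (d x) y - mul (tau x) (d y)).
  move=> a u v; rewrite cx_d_linear linearP (mulL y a) (mulL (d y) a).
  by rewrite opprD scalerBr addrACA.
apply: (homog_lin_ext l1 l2) => i z hz.
rewrite (dga_leibniz _ hz) (tauE hz) (linZ (mulL (d y))) -scaleNr.
congr (_ + _ *: _); rewrite -[RHS]mulN1r -[X in X * _](expr1z (-1 : k)) -signzD.
by apply: signz_eq; lia.
Qed.

Lemma d_one : d (dga_one A) = 0.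
Proof.
have := d_mul (dga_one A) (dga_one A).
rewrite (tauE (@dga_one_degree k A)) add0r expr1z scaleN1r.
rewrite (linN (dga_mul_linearl _)) opprK !dga_mul1x dga_mulx1 => /eqP.
by rewrite -subr_eq0 opprD addrA subrr add0r oppr_eq0 => /eqP.
Qed.

Variable V : gradedSpace k.
Implicit Types (phi psi chi : seq V -> A).

(** Convolution product along deconcatenation, taken without Koszul signs; these are carried by
    [flip]. *)
Definition cup phi psi xs : A := ssum (fun u v => mul (phi u) (psi v)) xs.

Definition flip phi (xs : seq V) : A := phi (map tau xs).

Lemma eq_cup phi phi' psi psi' xs :
  (forall u v, u ++ v = xs -> mul (phi u) (psi v) = mul (phi' u) (psi' v)) ->
  cup phi psi xs = cup phi' psi' xs.
Proof. exact: eq_ssum. Qed.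

Lemma cup_eq0 phi psi xs :
  (forall u v, u ++ v = xs -> phi u = 0 \/ psi v = 0) -> cup phi psi xs = 0.
Proof.
move=> h; apply: ssum_eq0 => u v /h[->|->]; first exact: dga_mul0x.
exact: dga_mulx0.
Qed.

Lemma cupDl phi phi' psi xs :
  cup (fun w => phi w + phi' w) psi xs = cup phi psi xs + cup phi' psi xs.
Proof.
by rewrite /cup -ssumD; apply: eq_ssum => u v _; rewrite (linD (dga_mul_linearl _)).
Qed.

Lemma cupDr phi psi psi' xs :
  cup phi (fun w => psi w + psi' w) xs = cup phi psi xs + cup phi psi' xs.
Proof.
by rewrite /cup -ssumD; apply: eq_ssum => u v _; rewrite (linD (dga_mul_linearr _)).
Qed.

Lemma cupNl phi psi xs : cup (fun w => - phi w) psi xs = - cup phi psi xs.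
Proof.
by rewrite /cup -ssumN; apply: eq_ssum => u v _; rewrite (linN (dga_mul_linearl _)).
Qed.

Lemma cupNr phi psi xs : cup phi (fun w => - psi w) xs = - cup phi psi xs.
Proof.
by rewrite /cup -ssumN; apply: eq_ssum => u v _; rewrite (linN (dga_mul_linearr _)).
Qed.

Lemma cupA phi psi chi xs : cup (cup phi psi) chi xs = cup phi (cup psi chi) xs.
Proof.
transitivity (ssum (fun u w => ssum (fun a b => mul (mul (phi a) (psi b)) (chi w)) u) xs).
  apply: eq_ssum => u w _.
  exact: (ssum_lin (L := mul^~ (chi w)) _ _ (dga_mul_linearl _)).
rewrite ssumA; apply: eq_ssum => a w _.
rewrite (ssum_lin _ _ (dga_mul_linearr _)); apply: eq_ssum => u v _.
by rewrite dga_mulA.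
Qed.

Lemma cup_flip phi psi xs : cup phi psi (map tau xs) = cup (flip phi) (flip psi) xs.
Proof. exact: ssum_map. Qed.

Lemma flipK phi xs : flip (flip phi) xs = phi xs.
Proof. by rewrite /flip map_tauK. Qed.

Lemma multilinear_cup phi psi : multilinear phi -> multilinear psi ->
  multilinear (cup phi psi).
Proof.
move=> h h'; apply: multilinear_ssum => [v|u].
  exact: (multilinear_lin (L := mul^~ (psi v)) (dga_mul_linearl _)).
exact: (multilinear_lin (dga_mul_linearr _)).
Qed.

Lemma multilinear_flip phi : multilinear phi -> multilinear (flip phi).
Proof. exact: multilinear_map. Qed.

Lemma sdeg_cup e e' phi psi : sdeg e phi -> sdeg e' psi -> sdeg (e + e') (cup phi psi).
Proof.
move=> h h' xs hxs; apply: sdeg_ssum => // u v euv hu hv.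
apply: homog_degE (dga_mul_degree (h u hu) (h' v hv)) _.
rewrite -euv degs_cat size_cat; lia.
Qed.

Lemma d_cup phi psi xs : d (cup phi psi xs) =
  cup (fun w => d (phi w)) psi xs - cup (fun w => tau (phi w)) (fun w => d (psi w)) xs.
Proof.
rewrite /cup (ssum_lin _ _ (@cx_d_linear k A)) -ssumN -ssumD.
by apply: eq_ssum => u v _; rewrite d_mul.
Qed.

(** The insertion happens on one side of the cut. When it is on the right, every letter of the left
    factor has met [tau], hence the [flip]. *)
Lemma ins_cup b phi psi xs : ins b (cup phi psi) xs =
  cup (ins b phi) psi xs + cup (flip phi) (ins b psi) xs.
Proof.
rewrite /ins; under eq_ssum => u w _ do under eq_psum => v t _ _ do
  rewrite [cup _ _ _]ssum_mid ssum_map.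
under eq_ssum => u w _ do rewrite psumD.
rewrite ssumD addrC; congr (_ + _).
  transitivity (ssum (fun u w => ssum (fun x q => psum (fun v a =>
      mul (phi (map tau u ++ b v :: a)) (psi q)) x) w) xs).
    apply: eq_ssum => u w _.
    by rewrite (ssum_psumA (fun v a q => mul (phi (map tau u ++ b v :: a)) (psi q))).
  rewrite -ssumA; apply: eq_ssum => p q _.
  rewrite (ssum_lin (L := mul^~ (psi q)) _ _ (dga_mul_linearl _)); apply: eq_ssum => u w _.
  by rewrite (psum_lin (L := mul^~ (psi q)) _ _ (dga_mul_linearl _)).
under eq_ssum => u w _ do rewrite -ssum_psum_exchange.
rewrite ssumA; apply: eq_ssum => p q _.
rewrite (ssum_lin _ _ (dga_mul_linearr _)); apply: eq_ssum => u w _.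
by rewrite (psum_lin _ _ (dga_mul_linearr _)).
Qed.

Lemma pull_cup (W : gradedSpace k) (f : seq W -> V) phi psi xs :
  pull f (cup phi psi) xs =
  ssum (fun u v => mul (pull f phi u) (pull f psi v)) xs.
Proof.
rewrite pull_split; apply: eq_ssum => u v _.
rewrite -(@pull_lin _ W V A A (fun x => mul x _) f phi u (dga_mul_linearl _)).
by apply: eq_pullr => a; rewrite (@pull_lin _ W V A A (mul (phi a)) _ _ _ (dga_mul_linearr _)).
Qed.

Section Differential.
Variable b : seq V -> V.
Hypothesis btau : forall v, v != [::] -> b (map tau v) = - tau (b v).

(** [d] commutes with [ins b], so [dplus] after [dminus] vanishes on multilinear functions once [b]
    squares to zero; [flip] exchanges the two because [b] anticommutes with [tau]. *)
Definition dminus phi xs : A := d (phi xs) - ins b phi xs.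
Definition dplus phi xs : A := d (phi xs) + ins b phi xs.

Lemma dplus_flip phi xs : multilinear phi ->
  dplus (flip phi) xs = flip (dminus phi) xs.
Proof. by move=> h; rewrite /dplus /flip /dminus ins_tau // opprK. Qed.

Fact dplus_cup phi psi xs : multilinear phi ->
  dplus (cup (flip phi) psi) xs = cup (flip (dminus phi)) psi xs -
  cup (fun w => tau (flip phi w)) (fun w => d (psi w)) xs + cup phi (ins b psi) xs.
Proof.
move=> h; rewrite /dplus d_cup ins_cup addrACA -[RHS]addrA; congr (_ + _).
  by rewrite -cupDl; apply: eq_cup => u v _; rewrite -dplus_flip.
by congr (_ + _); apply: eq_cup => u v _; rewrite flipK.
Qed.

(** The product rule when the left factor is a twisting function, of shifted degree -1. The even
    version serves gauge transformations, of shifted degree 0. *)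
Lemma dplus_cup_odd phi psi xs : multilinear phi ->
  (forall u, phi (map tau u) = tau (phi u)) ->
  dplus (cup (flip phi) psi) xs =
  cup (flip (dminus phi)) psi xs - cup phi (dminus psi) xs.
Proof.
move=> h ht; rewrite dplus_cup // -addrA; congr (_ + _).
rewrite /dminus cupDr cupNr opprD opprK; congr (- _ + _).
by apply: eq_cup => u v _; rewrite /flip ht tauK.
Qed.

Lemma dplus_cup_even phi psi xs : multilinear phi ->
  (forall u, phi (map tau u) = - tau (phi u)) ->
  dplus (cup (flip phi) psi) xs =
  cup (flip (dminus phi)) psi xs + cup phi (dplus psi) xs.
Proof.
move=> h ht; rewrite dplus_cup // -addrA; congr (_ + _).
rewrite /dplus cupDr -cupNl; congr (_ + _).
by apply: eq_cup => u v _; rewrite /flip ht linearN opprK tauK.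
Qed.

End Differential.

End DgAlgebra.

(** The operations of a dg-algebra stop at two inputs, so only the cuts into one or two blocks
    survive; [flip] comes from the [tau] that [bar] puts on the first of two inputs. *)
Lemma pull_dga_op (k : fieldType) (A : dgAlgebra k) (V : gradedSpace k)
    (f : seq V -> A) xs :
  f [::] = 0 -> (forall v, f (map tau v) = tau (f v)) -> xs != [::] ->
  pull f (bar (@dga_op k A)) xs = cx_d (f xs) + cup (flip f) f xs.
Proof.
move=> f0 ht xs0; rewrite pull_psum // psum_last // pull_nil addrC; congr (_ + _).
have ff0 : flip f [::] = 0 := f0.
rewrite [RHS]ssumE ff0 dga_mul0x add0r [RHS]psum_last // f0 dga_mulx0 addr0.
apply: eq_psum => u [|y v] // _ u0; rewrite pull_psum // psum_last // pull_nil.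
rewrite psum_eq0 ?add0r => [|u' [|z v'] // _ _]; first by rewrite /flip ht.
rewrite (eq_pull (f' := f) (phi' := fun=> 0)) ?pull_eq0 //.
by case=> [_ /(_ isT)|x ws _ _].
Qed.

(** * Contraction and existence *)

Section ContractionToHomology.
Variables (k : fieldType) (C : chainComplex k).
Local Notation d := (@cx_d k C).
Local Notation dl := (@cx_d_linear k C).

(* With [h0] a quasi-inverse of [d], [d h0] and [h0 d] project onto the
   boundaries and onto a complement of the cycles. *)
Lemma contraction : exists (i : {linear homology C -> C})
    (p : {linear C -> homology C}) (h : {linear C -> C}),
  [/\ [/\ forall n q, homog n q -> homog n (i q),
          forall n x, homog n x -> homog n (p x) &
          forall n x, homog n x -> homog (n + 1) (h x)],
      forall q, d (i q) = 0,
      forall x, p (d x) = 0,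
      forall z : Defs.cycle C, p (cycle_val z) = hclass z &
      [/\ forall q, p (i q) = q & forall x, d (h x) + h (d x) = i (p x) - x]].
Proof.
have [h0 [h0d h0P]] := graded_quasi_inverse C.
have h0l : linear h0 := linearP h0.
have e_cycle x : is_cycle (x - h0 (d x)).
  by apply/eqP; rewrite (linB dl) h0P subrr.
(* [1 - h0 d] is a projection onto the cycles, which extends the class map from cycles to all of
   [C]. *)
pose p x : homology C := hclass (Cycle (e_cycle x)).
have pl : linear p.
  move=> a x y; rewrite /p -hclass_linear; congr hclass; apply: val_inj => /=.
  by rewrite dl h0l scalerBr opprD addrACA.
have p_cycle (z : Defs.cycle C) : p (cycle_val z) = hclass z.
  apply/hclass_eq; exists 0; rewrite (lin0 dl) /=.
  by rewrite (eqP (cycle_valP z)) linear0 subr0 subrr.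
(* [s] kills boundaries, so the lift [i] of a class does not depend on the representative. *)
pose s x : C := x - d (h0 x).
have sl : linear s.
  by move=> a x y; rewrite /s h0l dl scalerBr opprD addrACA.
pose i (q : homology C) : C := s (cycle_val (hrepr q)).
have iE z : i (hclass z) = s (cycle_val z).
  have /hclass_eq[u eu] := hreprK (hclass z).
  apply/eqP; rewrite /i -subr_eq0 -(linB sl) -eu /s h0P subrr //.
have il : linear i.
  move=> a q q'; rewrite -[q]hreprK -[q']hreprK -hclass_linear !iE.
  exact: sl.
have dh0 n x : homog n x -> homog n (d (h0 x)).
  by move=> hx; apply: homog_degE (cx_d_degree (h0d _ _ hx)) _; rewrite addrK.
have h0dd n x : homog n x -> homog n (h0 (d x)).
  by move=> hx; apply: homog_degE (h0d _ _ (cx_d_degree hx)) _; rewrite subrK.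
(* This is [- s h0]. Since [i p = (1 - d h0)(1 - h0 d)], expanding the product gives
   [d h + h d = i p - 1]. *)
pose h x : C := d (h0 (h0 x)) - h0 x.
have hl : linear h.
  by move=> a x y; rewrite /h !h0l dl scalerBr opprD addrACA.
have di q : d (i q) = 0.
  by rewrite /i (linB dl) cx_d_square subr0 (eqP (cycle_valP _)).
exists (linear_of il), (linear_of pl), (linear_of hl); split=> //=.
- split=> [n _ [z hz <-]|n x hx|n x hx]; rewrite /= ?iE.
  + by apply: homogB => //; exact: dh0.
  + by exists (Cycle (e_cycle x)) => //=; apply: homogB => //; exact: h0dd.
  + by apply: homogB; [apply/dh0/h0d | exact: h0d].
- by move=> x; have := p_cycle (Cycle (introT eqP (cx_d_square x))) => /= ->;
    rewrite -(linear0 (@hclass k C)); apply/hclass_eq; exists x; rewrite subr0.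
split=> [q|x].
  rewrite -[q]hreprK; set z := hrepr q.
  have := p_cycle (Cycle (introT eqP (di (hclass z)))) => /= ->.
  apply/hclass_eq; exists (- h0 (cycle_val z)) => /=.
  by rewrite iE (linN dl) /s addrAC subrr add0r.
rewrite iE /= /h /s (linB dl) cx_d_square sub0r [d (h0 (_ - _))](_ : _ =
    d (h0 x) - d (h0 (h0 (d x)))); last by rewrite linearB (linB dl).
rewrite opprB [in RHS]addrACA addrA.
by rewrite [RHS]addrC -!addrA addKr [LHS]addrCA; congr (_ + _); exact: addrC.
Qed.
End ContractionToHomology.

(** * Recursion on the length of words *)

Section WordRecursion.
Variables (T W : Type) (w0 : W).

Definition trunc n (f : seq T -> W) xs := if (size xs < n)%N then f xs else w0.

(** Truncation hides from [Psi] the values not yet defined, replacing them by [w0]. The property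
    [Q], here multilinearity and degree, only has to be checked one length at a time, so it passes
    from the iterates to their limit. *)
Lemma word_recursion (Q : (seq T -> W) -> Prop) (Psi : (seq T -> W) -> seq T -> W) :
  Q (fun=> w0) -> (forall n f, Q f -> Q (trunc n f)) -> (forall f, Q f -> Q (Psi f)) ->
  (forall f, (forall n, exists2 f', Q f' & forall xs, size xs = n -> f xs = f' xs) ->
     Q f) ->
  exists f, Q f /\ forall xs, f xs = Psi (trunc (size xs) f) xs.
Proof.
move=> Q0 Qtrunc QPsi Qloc.
pose G f xs := Psi (trunc (size xs) f) xs.
(* On words of length n the iterates are stationary from the one of index n + 1 on. *)
pose F n := iter n G (fun=> w0); pose f xs := F (size xs).+1 xs.
have QG g : Q g -> Q (G g).
  move=> Qg; apply: Qloc => n; exists (Psi (trunc n g)); first exact/QPsi/Qtrunc.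
  by move=> xs <-.
have QF n : Q (F n) by elim: n => [//|n IH]; exact: QG.
have Ff n xs : (size xs < n)%N -> F n xs = f xs.
  have [N] := ubnP n; elim: N => // N IH in n xs *; case: n => // n nN xn.
  rewrite /f /F !iterS -!/(F _) /G; congr (Psi _ xs); apply: funext => ys.
  rewrite /trunc; case: ifP => // yx; rewrite (IH n) // ?(leq_trans yx xn) //.
  by rewrite (IH (size xs)) //; exact: leq_ltn_trans (xn : (size xs <= n)%N) (nN : (n < N)%N).
exists f; split.
  by apply: Qloc => n; exists (F n.+1) => // xs <-.
move=> xs; rewrite {1}/f /F iterS -/(F _) /G; congr (Psi _ xs); apply: funext => ys.
by rewrite /trunc; case: ifP => // yx; exact: Ff.
Qed.

End WordRecursion.

Section Locality.
Variables (k : fieldType) (V W : gradedSpace k).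
Implicit Type f : seq V -> W.

Lemma multilinear_local f : (forall n, exists2 f', multilinear f' &
  forall xs, size xs = n -> f xs = f' xs) -> multilinear f.
Proof.
move=> h s t; have [f' hf' e] := h (size s + (size t).+1)%N.
by move=> a x y; rewrite !e ?size_cat //; exact: hf'.
Qed.

Lemma sdeg_local e f : (forall n, exists2 f', sdeg e f' &
  forall xs, size xs = n -> f xs = f' xs) -> sdeg e f.
Proof.
move=> h xs hxs; have [f' hf' ef] := h (size xs).
by rewrite ef ?size_map //; exact: hf'.
Qed.

Lemma multilinear_trunc n f : multilinear f -> multilinear (trunc 0 n f).
Proof.
by move=> h; apply: (multilinear_if (fun m => m < n)%N) => //; exact: multilinear_zero.
Qed.

Lemma sdeg_trunc e n f : sdeg e f -> sdeg e (trunc 0 n f).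
Proof.
by move=> h; apply: (sdeg_if (fun m => m < n)%N) => //; exact: sdeg_zero.
Qed.

End Locality.

Section Existence.
Variables (k : fieldType) (A : dgAlgebra k) (H : gradedSpace k).
Local Notation d := (@cx_d k A).
Variables (i : {linear H -> A}) (p : {linear A -> H}) (h : {linear A -> A}).
Hypothesis i_deg : forall n q, homog n q -> homog n (i q).
Hypothesis p_deg : forall n x, homog n x -> homog n (p x).
Hypothesis h_deg : forall n x, homog n x -> homog (n + 1) (h x).
Hypothesis di : forall q, d (i q) = 0.
Hypothesis pd : forall x, p (d x) = 0.
Hypothesis htpy : forall x, d (h x) + h (d x) = i (p x) - x.

Theorem transfer : exists (F : seq H -> A) (b : seq H -> H),
  [/\ [/\ multilinear F, sdeg (-1) F & F [::] = 0],
      [/\ multilinear b, sdeg (-2) b & forall xs, ins b b xs = 0],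
      forall xs, b xs = p (cup (flip F) F xs),
      forall x, F [:: x] = i x &
      forall xs, ins b F xs = d (F xs) + cup (flip F) F xs].
Proof.
pose Psi F xs := i (eta xs) + h (cup (flip F) F xs).
have hpsi F : multilinear F -> multilinear (Psi F).
  move=> hF; apply: multilinearD.
    exact: (@multilinear_lin k H H A i _ (linearP i) (@multilinear_eta k H)).
  apply: (@multilinear_lin k H A A h _ (linearP h)).
  by apply: multilinear_cup => //; exact: multilinear_flip.
have dpsi F : sdeg (-1) F -> sdeg (-1) (Psi F).
  move=> dF; apply: sdegD.
    move=> xs hxs; apply: i_deg; exact: sdeg_eta.
  apply: (@sdeg_lin k H A A (-2) 1 h) => //.
  exact: (sdeg_cup (sdeg_maptau dF) dF).
have [||||F [[hF dF] FE]] := @word_recursion H A 0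
    (fun F => multilinear F /\ sdeg (-1) F) Psi.
- by split; [exact: multilinear_zero | exact: sdeg_zero].
- by move=> n F [hF dF]; split; [exact: multilinear_trunc | exact: sdeg_trunc].
- by move=> F [hF dF]; split; [exact: hpsi | exact: dpsi].
- by move=> F hloc; split; [apply: multilinear_local | apply: sdeg_local] => n;
    have [f' [h1 h2] e] := hloc n; exists f'.
have F0 : F [::] = 0.
  by rewrite FE /Psi /eta linear0 add0r [cup _ _ _]ssum_nil dga_mulx0 linear0.
pose lam := cup (flip F) F.
have {}FE xs : F xs = i (eta xs) + h (lam xs).
  (* Truncation is harmless here: a factor of full length faces the empty word, where [F] is 0. *)
  rewrite FE /Psi; congr (_ + h _); apply: eq_ssum => u v e.
  have tr w : (size w < size xs)%N -> trunc 0 (size xs) F w = F w by rewrite /trunc => ->.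
  have [v0|v0] := eqVneq v [::].
    by rewrite v0 /trunc; case: ifP => _; rewrite F0 !dga_mulx0.
  have [u0|u0] := eqVneq u [::].
    rewrite u0 /flip /= /trunc; case: ifP => _; rewrite F0 !dga_mul0x //.
  by rewrite /flip !tr ?size_map // -e size_cat; case: u u0 {e}; case: v v0 => //= *; lia.
pose b xs := p (lam xs).
have hlam : multilinear lam by apply: multilinear_cup => //; exact: multilinear_flip.
have dlam : sdeg (-2) lam := sdeg_cup (sdeg_maptau dF) dF.
have hb : multilinear b := multilinear_lin (linearP p) hlam.
have db : sdeg (-2) b.
  by move=> xs hxs; apply: p_deg; exact: dlam.
have btau v : v != [::] -> b (map tau v) = - tau (b v) by move=> _; exact: sdeg_tauN2.
have Ftau v : F (map tau v) = tau (F v) by exact: sdeg_tauN1.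
pose K xs := dminus b F xs + lam xs.
(* In the product rule for [lam] the curvature replaces [dminus b F]; the cubic terms so introduced
   cancel by associativity. *)
have dpl xs : dplus b lam xs = cup (flip K) F xs - cup F K xs.
  have e1 : cup (flip K) F xs = cup (flip (dminus b F)) F xs + cup (flip lam) F xs.
    exact: cupDl.
  have e2 : cup F K xs = cup F (dminus b F) xs + cup F lam xs by exact: cupDr.
  have e3 : cup (flip lam) F xs = cup F lam xs.
    rewrite -cupA; apply: eq_cup => u v _; congr (dga_mul _ _).
    by rewrite [flip lam u]cup_flip; apply: eq_cup => x y _; rewrite flipK.
  by rewrite dplus_cup_odd // e1 e2 e3 opprD addrACA subrr addr0.
have lam0 : lam [::] = 0 by rewrite /lam /cup ssum_nil F0 dga_mulx0.
have K0 : K [::] = 0.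
  by rewrite /K /dminus ins_nil lam0 F0 (lin0 (@cx_d_linear k A)) subr0 addr0.
(* [d F = d h lam], and the homotopy turns it into [i b - lam - h d lam]. The first two terms cancel
   against [ins b F], which is [i b + h (ins b lam)], and against the [lam] in [K]. *)
have KE xs : xs != [::] -> K xs = - h (dplus b lam xs).
  move=> xs0; have -> : K xs = d (h (lam xs)) - (i (b xs) + h (ins b lam xs)) + lam xs.
    congr (_ - _ + _); first by rewrite FE (linD (@cx_d_linear k A)) di add0r.
    rewrite -(ins_eta b xs0) (ins_lin _ _ _ (linearP i)) (ins_lin _ _ _ (linearP h)).
    by rewrite -insD; apply: eq_ins => // ws _; rewrite FE.
  have -> : d (h (lam xs)) = i (b xs) - lam xs - h (d (lam xs)).
    by rewrite -htpy addrK.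
  rewrite /dplus (linD (linearP h)) !opprD addrAC [X in X + _]addrAC subrK.
  by rewrite addrACA subrr add0r.
(* As [F [::] = 0], the factor [F] uses up at least one letter in both products, so [K] is met only
   on shorter words. *)
have {KE}K0' xs : K xs = 0.
  have [n] := ubnP (size xs); elim: n => // n IH in xs *; move=> sn.
  have [->//|xs0] := eqVneq xs [::].
  rewrite KE // dpl !cup_eq0 ?subrr ?linear0 ?oppr0 // => u v e.
    have [->|u0] := eqVneq u [::]; first by left.
    by right; apply: IH; apply: leq_trans (size_psplit e u0) _.
  have [->|v0] := eqVneq v [::]; first by right.
  left; apply: IH; rewrite size_map; apply: leq_trans _ (sn : (size xs <= n)%N).
  by rewrite -e size_cat; case: v v0 {e} => //= *; lia.
exists F, b; split=> //.
(* [ins b b] is [p] applied to [dplus b lam - d lam]: the first term vanishes with the curvature,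
   the second is a boundary. *)
- split=> // xs; have := ins_lin b lam xs (linearP p); rewrite -/b => <-.
  have -> : ins b lam xs = dplus b lam xs - d (lam xs) by rewrite /dplus addrC addKr.
  rewrite linearB /= pd subr0 dpl !cup_eq0 ?subrr ?linear0 // => u v _.
    by right.
  by left; exact: K0'.
- move=> x; rewrite FE /= /lam /cup ssum_cons ssum_nil F0 dga_mulx0 addr0.
  by rewrite [flip F [::]]F0 dga_mul0x linear0 addr0.
- by move=> xs; have /eqP := K0' xs; rewrite /K /dminus addrAC subr_eq0 => /eqP <-.
Qed.

End Existence.

(** * Comparison of twisting functions *)

Section Truncation.
Variables (k : fieldType) (V W : gradedSpace k).

(** Insertion on a single letter is the only one that keeps the length, and it gives 0 when
    [b_1 = 0]. *)
Lemma ins_trunc (b : seq V -> V) (phi : seq V -> W) xs :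
  (forall x, b [:: x] = 0) -> multilinear phi ->
  ins b (trunc 0 (size xs) phi) xs = ins b phi xs.
Proof.
move=> b1 hphi; apply: eq_ssum => u w e; apply: eq_psum => v t e' v0.
case: v v0 e' => [//|x [|y v]] _ e'.
  by rewrite b1 (multilinear0 _ _ hphi) multilinear0 //; exact: multilinear_trunc.
by rewrite /trunc -e -e' !size_cat /= size_map; case: ifP => //; lia.
Qed.

Lemma pull_trunc (X : gradedSpace k) (f : seq V -> W) (phi : seq W -> X) xs :
  multilinear phi -> xs != [::] ->
  pull f phi xs = pull (trunc 0 (size xs) f) phi xs + phi [:: f xs].
Proof.
move=> hphi xs0; rewrite !pull_psum // psum_last // pull_nil; congr (_ + _).
rewrite [RHS]psum_last // pull_nil {3}/trunc ltnn (multilinear0 [::] [::] hphi) addr0.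
apply: eq_psum => u [|y v] // e u0.
have su : (size u < size xs)%N by rewrite -e size_cat /=; lia.
rewrite {2}/trunc su; apply: eq_pull => // w _ sw.
by rewrite /trunc (leq_ltn_trans sw (size_psplit e u0)).
Qed.

End Truncation.

Section Comparison.
Variables (k : fieldType) (A : dgAlgebra k) (H : gradedSpace k).
Local Notation d := (@cx_d k A).
Local Notation dl := (@cx_d_linear k A).
Variables (i : {linear H -> A}) (p : {linear A -> H}) (h : {linear A -> A}).
Hypothesis p_deg : forall n x, homog n x -> homog n (p x).
Hypothesis h_deg : forall n x, homog n x -> homog (n + 1) (h x).
Hypothesis pd : forall x, p (d x) = 0.
Hypothesis htpy : forall x, d (h x) + h (d x) = i (p x) - x.

Variables (b b1 : seq H -> H) (al al1 : seq H -> A).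
Hypotheses (hb : multilinear b) (db : sdeg (-2) b).
Hypotheses (bb : forall xs : seq H, ins b b xs = 0) (b_min : forall x, b [:: x] = 0).
Hypotheses (hal : multilinear al) (dal : sdeg (-1) al) (al0 : al [::] = 0).
Hypotheses (hal1 : multilinear al1) (dal1 : sdeg (-1) al1) (al10 : al1 [::] = 0).
Hypothesis al_eq : forall xs : seq H, ins b al xs = d (al xs) + cup (flip al) al xs.
Hypothesis al1_eq : forall xs : seq H, ins b1 al1 xs = d (al1 xs) + cup (flip al1) al1 xs.
Hypotheses (p_al : forall x, p (al [:: x]) = x) (p_al1 : forall x, p (al1 [:: x]) = x).

Let al1l : linear (fun x => al1 [:: x]) := hal1 [::] [::].
Let btau (v : seq H) : v != [::] -> b (map tau v) = - tau (b v).
Proof. by move=> _; exact: sdeg_tauN2. Qed.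

(* [gauge f g = 0] says that [g] is a homotopy (a gauge transformation) from
   [al] to the composite [pull f al1]. *)
Definition gauge (f : seq H -> H) (g : seq H -> A) xs : A :=
  dminus b g xs + cup (flip (pull f al1)) g xs - cup (flip g) (flip al) xs.

Lemma multilinear_dminus (g : seq H -> A) : multilinear g -> multilinear (dminus b g).
Proof.
move=> hg; apply: multilinearD; first exact: (multilinear_lin dl).
exact/multilinearN/multilinear_ins.
Qed.

Lemma multilinear_gauge f g : multilinear f -> multilinear g ->
  multilinear (gauge f g).
Proof.
move=> hf hg; apply: multilinearD.
  apply: multilinearD; first exact: multilinear_dminus.
  apply: multilinear_cup => //; apply: multilinear_flip; exact: multilinear_pull.
apply: multilinearN; apply: multilinear_cup; exact: multilinear_flip.
Qed.

Lemma sdeg_gauge f g : sdeg (-1) f -> sdeg 0 g -> sdeg (-1) (gauge f g).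
Proof.
move=> df dg; apply: sdegD.
  apply: sdegD.
    apply: sdegD.
      apply: (@sdeg_lin k H A A 0 (-1) d) => //; exact: cx_d_degree.
    exact: (sdegN (sdeg_ins db dg)).
  exact: (sdeg_cup (sdeg_maptau (sdeg_pull df dal1)) dg).
exact: (sdegN (sdeg_cup (sdeg_maptau dg) (sdeg_maptau dal))).
Qed.

(** [K] is the curvature of [al'], and [al] has none by [al_eq]. The [dminus b g] part of the gauge
    defect is closed, and the terms containing two twisting functions match by associativity. *)
Lemma gauge_bianchi f g xs : multilinear f -> sdeg (-1) f ->
  multilinear g -> sdeg 0 g ->
  let al' := pull f al1 in
  let K v := dminus b al' v + cup (flip al') al' v in
  dplus b (gauge f g) xs = cup (flip K) g xs - cup al' (gauge f g) xs
    - cup (flip (gauge f g)) (flip al) xs.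
Proof.
move=> hf df hg dg al' K.
have hal' : multilinear al' by exact: multilinear_pull.
have dal' : sdeg (-1) al' by exact: sdeg_pull.
have al'tau v : al' (map tau v) = tau (al' v) by exact: sdeg_tauN1.
have gtau v : g (map tau v) = - tau (g v) by exact: sdeg_tau0.
have flip_cup phi psi v : flip (cup (flip phi) psi) v = cup phi (flip psi) v.
  by rewrite [LHS]cup_flip; apply: eq_cup => x y _; rewrite flipK.
have ddg : dplus b (dminus b g) xs = 0.
  rewrite /dplus {1}/dminus (linB dl) cx_d_square sub0r (ins_lin _ _ _ dl).
  rewrite [ins b (dminus b g) xs](insD b (fun ws => d (g ws)) (fun ws => - ins b g ws)).
  by rewrite insN ins_ins // subr0 addNr.
have eE : dplus b (gauge f g) xs = cup (flip (dminus b al')) g xs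
    - cup al' (dminus b g) xs - (cup (flip (dminus b g)) (flip al) xs
    - cup g (cup al (flip al)) xs).
  have -> : cup g (cup al (flip al)) xs = - cup g (dplus b (flip al)) xs.
    rewrite -cupNr; apply: eq_cup => u v _; rewrite dplus_flip //.
    have -> : flip (dminus b al) v = - flip (cup (flip al) al) v.
      by rewrite /flip /dminus al_eq opprD addrA subrr add0r.
    by rewrite opprK flip_cup.
  rewrite opprK -dplus_cup_even // -dplus_cup_odd //.
  rewrite /dplus {1}/gauge (linB dl) (linD dl).
  rewrite [ins b (gauge f g) xs](insD b
    (fun ws => dminus b g ws + cup (flip al') g ws)
    (fun ws => - cup (flip g) (flip al) ws)) insN insD.
  rewrite addrACA -opprD; congr (_ - _).
  by rewrite addrACA -/(dplus b (dminus b g) xs) ddg add0r.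
have e1 : cup (flip K) g xs = cup (flip (dminus b al')) g xs
    + cup al' (cup (flip al') g) xs.
  rewrite -cupA [LHS](@cupDl k A H (flip (dminus b al')) (flip (cup (flip al') al'))).
  by congr (_ + _); apply: eq_cup => u v _; rewrite flip_cup.
have e2 : cup al' (gauge f g) xs = cup al' (dminus b g) xs
    + cup al' (cup (flip al') g) xs - cup al' (cup (flip g) (flip al)) xs.
  by rewrite -cupDr -cupNr -cupDr.
have e3 : cup (flip (gauge f g)) (flip al) xs = cup (flip (dminus b g)) (flip al) xs
    + cup al' (cup (flip g) (flip al)) xs - cup g (cup al (flip al)) xs.
  rewrite -!cupA -cupNl.
  have -> : cup (cup al' (flip g)) (flip al) xs = cup (flip (cup (flip al') g)) (flip al) xs.
    by apply: eq_cup => u v _; rewrite flip_cup.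
  rewrite -cupDl.
  have -> : cup (fun w => - cup g al w) (flip al) xs =
      cup (flip (fun w => - cup (flip g) (flip al) w)) (flip al) xs.
    apply: eq_cup => u v _; congr (dga_mul _ _); rewrite /flip; congr (- _).
    by rewrite cup_flip; apply: eq_cup => x y _; rewrite !flipK.
  by rewrite -cupDl.
rewrite eE e1 e2 e3.
rewrite [X in _ = _ - X - _]addrAC [X in _ = _ + X - _]opprD [X in _ = X - _]addrACA subrr addr0.
rewrite [X in _ = _ - X]addrAC [X in _ = _ + X]opprD.
rewrite [X in _ = _ + X + _]opprB [X in _ = X + _]addrA [X in _ = X + _]addrAC [RHS]addrACA.
by rewrite subrr addr0.
Qed.

Section Gauge.
Variables (f : seq H -> H) (g : seq H -> A).
Hypotheses (hf : multilinear f) (df : sdeg (-1) f).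
Hypotheses (hg : multilinear g) (dg : sdeg 0 g) (g0 : g [::] = dga_one A).

Let defect v := pull f b1 v - ins b f v.
Let al' := pull f al1.
Let K v := dminus b al' v + cup (flip al') al' v.

Let al'0 : al' [::] = 0.
Proof. by rewrite /al' pull_nil. Qed.

Lemma gauge0 : gauge f g [::] = 0.
Proof.
rewrite /gauge /dminus g0 d_one ins_nil subrr add0r /cup !ssum_nil.
have -> : flip al [::] = 0 := al0.
have -> : flip (pull f al1) [::] = 0 := al'0.
by rewrite dga_mul0x dga_mulx0 subrr.
Qed.

(** Isolates the two unknowns of full length. [g xs] appears only under [d], because [b_1 = 0] and
    the twisting functions vanish on the empty word; [f] on the full word appears only where [g]
    takes the empty word, with value 1. *)
Lemma gauge_trunc xs : xs != [::] -> gauge f g xs =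
  gauge (trunc 0 (size xs) f) (trunc 0 (size xs) g) xs + d (g xs) + al1 [:: f (map tau xs)].
Proof.
move=> xs0; have n0 : (0 < size xs)%N by case: xs xs0.
have short u y v : u ++ y :: v = xs -> (size u < size xs)%N.
  by move<-; rewrite size_cat /=; lia.
have e1 : dminus b g xs = dminus b (trunc 0 (size xs) g) xs + d (g xs).
  by rewrite /dminus ins_trunc // {1}/trunc ltnn (lin0 dl) sub0r addrC.
have e2 : cup (flip (pull f al1)) g xs =
    cup (flip (pull (trunc 0 (size xs) f) al1)) (trunc 0 (size xs) g) xs
    + al1 [:: f (map tau xs)].
  have gt0 : trunc 0 (size xs) g [::] = dga_one A by rewrite /trunc n0.
  rewrite [LHS]ssum_last [X in _ = X + _]ssum_last g0 gt0 !dga_mulx1 -addrA.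
  congr (_ + _); last first.
    rewrite /flip pull_trunc ?size_map //; first by case: (xs) xs0.
  apply: eq_ssum => u [|y v] // e; have su := short _ _ _ e.
  have [->|u0] := eqVneq u [::]; first by rewrite /flip /= !pull_nil al10 !dga_mul0x.
  congr (dga_mul _ _); last first.
    by rewrite /trunc (size_psplit e u0).
  apply: eq_pull => // w _; rewrite size_map => sw.
  by rewrite /trunc (leq_ltn_trans sw su).
have e3 : cup (flip g) (flip al) xs = cup (flip (trunc 0 (size xs) g)) (flip al) xs.
  apply: eq_ssum => u [|y v] e.
    by have -> : flip al [::] = 0 := al0; rewrite !dga_mulx0.
  by rewrite /flip /trunc size_map (short _ _ _ e).
have abel (x y z t u : A) : (x + t) + (y + u) - z = x + y - z + t + u.
  by rewrite -!addrA; congr (_ + _); rewrite addrCA; congr (_ + _); rewrite addrA addrC.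
by rewrite /gauge e1 e2 e3 abel.
Qed.

(** Since [al1] satisfies its own twisting equation for [b1], the curvature of its pullback measures
    only the failure of [f] to be a morphism. *)
Lemma K_coder xs : K xs = coder f al1 defect xs.
Proof.
have ftau v : v != [::] -> f (map tau v) = tau (f v) by move=> _; exact: sdeg_tauN1.
rewrite (coderB f hal1 (pull f b1) (ins b f)) -pull_ins // -(ins_pull hal1 b xs ftau).
rewrite /K /dminus addrAC; congr (_ - _).
rewrite (eq_pullr _ _ al1_eq) pullD (pull_lin _ _ _ dl); congr (_ + _).
rewrite pull_cup; apply: eq_cup => u v _; congr (dga_mul _ _).
by rewrite [LHS]pull_tau.
Qed.

(** By induction every term of the Bianchi identity vanishes except [K] on the whole flipped word
    times [g [::] = 1], and [coder_lead] reduces that [K] to [al1] of the defect. *)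
Lemma gauge_step xs : xs != [::] ->
  (forall u, (size u < size xs)%N -> gauge f g u = 0) ->
  (forall u, u != [::] -> (size u < size xs)%N -> defect u = 0) ->
  d (gauge f g xs) = al1 [:: defect (map tau xs)].
Proof.
move=> xs0 E0 D0.
have hE := multilinear_gauge hf hg.
have K0 u : (size u < size xs)%N -> K u = 0.
  have [->|u0] := eqVneq u [::] => su; rewrite K_coder.
    by rewrite /coder ssum_nil psum_nil.
  rewrite coder_lead // => [|v v0 sv]; first by rewrite D0 // (lin0 al1l).
  by apply: D0 => //; exact: ltn_trans sv su.
have := gauge_bianchi xs hf df hg dg; rewrite -/al' /= -/K /dplus.
rewrite -(ins_trunc _ b_min hE) (eq_ins (b' := b) (phi' := fun=> 0)) //; last first.
  by move=> ws _; rewrite /trunc; case: ifP => // /E0.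
have -> : ins b (fun=> 0 : A) xs = 0.
  by apply: ssum_eq0 => u w _; exact: psum_eq0.
rewrite addr0 => ->.
rewrite [cup al' _ _]cup_eq0 ?subr0; last first.
  move=> u v e; have [->|u0] := eqVneq u [::]; first by left.
  by right; apply/E0/(size_psplit e u0).
rewrite [cup (flip (gauge f g)) _ _]cup_eq0 ?subr0; last first.
  move=> u [|y v] e; first by right.
  by left; apply: E0; rewrite size_map -e size_cat /=; lia.
rewrite [LHS]ssum_last g0 dga_mulx1 ssum_eq0 ?add0r; last first.
  move=> u [|y v] // e; rewrite [flip K u]K0 ?dga_mul0x //.
  by rewrite size_map -e size_cat /=; lia.
rewrite [LHS]K_coder coder_lead //; first by case: (xs) xs0.
by rewrite size_map.
Qed.

End Gauge.

Let unit (xs : seq H) : A := if xs is [::] then dga_one A else 0.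

Let multilinear_unit : multilinear unit.
Proof. by case=> [|x s] t a u v /=; rewrite scaler0 addr0. Qed.

Let sdeg_unit : sdeg 0 unit.
Proof.
case=> [|x xs] _; last exact: homog0.
by rewrite /degs big_nil; exact: dga_one_degree.
Qed.

Theorem comparison : exists f : seq H -> H,
  [/\ multilinear f, sdeg (-1) f, forall x, f [:: x] = x &
      forall xs, xs != [::] -> pull f b1 xs = ins b f xs].
Proof.
pose E (fg : seq H -> H * A) := gauge (fun w => (fg w).1) (fun w => (fg w).2).
(* Solves the equation isolated in [gauge_trunc]: the first component removes the class of [E], the
   second bounds what is left. [map tau] undoes the [flip] there, and [unit] makes [g] equal to 1 on
   the empty word. *)
pose Psi fg xs := (- p (E fg (map tau xs)), h (E fg xs - al1 [:: p (E fg xs)]) + unit xs).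
pose Q (fg : seq H -> H * A) :=
  (multilinear (fun w => (fg w).1) /\ sdeg (-1) (fun w => (fg w).1)) /\
  (multilinear (fun w => (fg w).2) /\ sdeg 0 (fun w => (fg w).2)).
have trunc1 n fg : (fun w => (trunc (0, 0) n fg w).1) = trunc 0 n (fun w => (fg w).1).
  by apply: funext => w; rewrite /trunc; case: ifP.
have trunc2 n fg : (fun w => (trunc (0, 0) n fg w).2) = trunc 0 n (fun w => (fg w).2).
  by apply: funext => w; rewrite /trunc; case: ifP.
have [||||fg [[[hf df] [hg dg]] fgE]] := @word_recursion H (H * A) (0, 0) Q Psi.
- by split; split; (exact: multilinear_zero || exact: sdeg_zero).
- move=> n fg [[hf df] [hg dg]]; rewrite /Q trunc1 trunc2; split; split.
  + exact: multilinear_trunc.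
  + exact: sdeg_trunc.
  + exact: multilinear_trunc.
  + exact: sdeg_trunc.
- move=> fg [[hf df] [hg dg]].
  have hE : multilinear (E fg) by exact: multilinear_gauge.
  have dE : sdeg (-1) (E fg) by exact: sdeg_gauge.
  split; split.
  + exact: (multilinearN (multilinear_lin (linearP p) (multilinear_flip hE))).
  + apply: sdegN => xs hxs; apply: p_deg; exact: sdeg_maptau.
  + apply: multilinearD => //.
    have l : linear (fun x => h (x - al1 [:: p x])).
      have pl : linear p := linearP p.
      move=> a x y; rewrite pl al1l opprD addrACA -scalerBr.
      exact: linearP.
    exact: (multilinear_lin l hE).
  + apply: sdegD => //.
    apply: (@sdeg_lin k H A A (-1) 1 (fun x => h (x - al1 [:: p x])) (E fg)) => // n x hx.
    apply: h_deg; apply: homogB => //.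
    have := @dal1 [:: (n, p x)]; rewrite /degs big_seq1 /= addrK; apply.
    by move=> q; rewrite inE => /eqP ->; exact: p_deg.
- move=> fg hloc; split; split; (apply: multilinear_local || apply: sdeg_local) => n;
    have [fg' [[? ?] [? ?]] e] := hloc n.
  + by exists (fun w => (fg' w).1) => // xs /e ->.
  + by exists (fun w => (fg' w).1) => // xs /e ->.
  + by exists (fun w => (fg' w).2) => // xs /e ->.
  + by exists (fun w => (fg' w).2) => // xs /e ->.
pose f w := (fg w).1; pose g w := (fg w).2.
rewrite -/f -/g in hf df hg dg.
pose E0 xs := gauge (trunc 0 (size xs) f) (trunc 0 (size xs) g) xs.
have fE xs : f (map tau xs) = - p (E0 xs).
  by rewrite /f fgE /= /E trunc1 trunc2 size_map map_tauK.
have gE xs : g xs = h (E0 xs - al1 [:: p (E0 xs)]) + unit xs.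
  by rewrite /g fgE /= /E trunc1 trunc2.
have g0 : g [::] = dga_one A.
  have E00 : E0 [::] = 0.
    rewrite /E0 /gauge /dminus /cup !ssum_nil ins_nil /trunc /= (lin0 dl) subr0 add0r.
    have -> : flip al [::] = 0 := al0.
    by rewrite dga_mulx0 dga_mulx0 subrr.
  by rewrite gE E00 linear0 (lin0 al1l) subrr linear0 add0r.
have main xs : gauge f g xs = 0 /\ (xs != [::] -> pull f b1 xs - ins b f xs = 0).
  have [n] := ubnP (size xs); elim: n => // n IH in xs *; move=> sn.
  have [->|xs0] := eqVneq xs [::]; first by rewrite gauge0.
  (* Needed for all words of this length: the defect comes out at [map tau ys], so the defect at
     [xs] is reached from [ys = map tau xs]. *)
  have step ys : size ys = size xs -> p (al1 [:: pull f b1 (map tau ys) - ins b f (map tau ys)]) = 0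
      /\ d (gauge f g ys) = al1 [:: pull f b1 (map tau ys) - ins b f (map tau ys)].
    move=> sy; have <- : d (gauge f g ys) =
        al1 [:: pull f b1 (map tau ys) - ins b f (map tau ys)].
      apply: gauge_step => //.
      - by rewrite -size_eq0 sy size_eq0.
      - by move=> u; rewrite sy => su; have [] := IH u (leq_trans su sn).
      - by move=> u u0; rewrite sy => su; have [_] := IH u (leq_trans su sn); apply.
    by rewrite pd.
  split; last first.
    move=> _; have [] := step (map tau xs); first by rewrite size_map.
    by rewrite p_al1 map_tauK.
  have [e1 e2] := step xs erefl.
  rewrite p_al1 in e1; rewrite e1 (lin0 al1l) in e2.
  rewrite gauge_trunc // -/(E0 xs) in e2 *.
  (* [z] is a cycle with [p z = 0], so the homotopy yields [d (h z) = - z]. *)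
  pose z := E0 xs - al1 [:: p (E0 xs)].
  have ge : g xs = h z.
    by rewrite gE (_ : unit xs = 0) ?addr0 //; case: (xs) xs0.
  have ez : E0 xs + d (g xs) + al1 [:: f (map tau xs)] = z + d (h z).
    by rewrite fE (linN al1l) ge addrAC.
  rewrite ez in e2 *; have dz : d z = 0.
    by move: e2; rewrite (linD dl) cx_d_square addr0.
  have := htpy z; rewrite dz linear0 addr0 => ->.
  have -> : p z = 0 by rewrite (linB (linearP p)) p_al1 subrr.
  by rewrite linear0 sub0r subrr.
exists f; split=> // [x|xs xs0]; last first.
  by apply/eqP; rewrite -subr_eq0; apply/eqP; have [_] := main xs; apply.
(* In length one the gauge equation says that [al1 [:: f [:: x]]] and [al [:: x]] differ by a
   boundary; [p] then gives [f_1 = id]. *)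
have [+ _] := main [:: tau x]; rewrite /gauge /dminus /ins /cup !ssum_cons !ssum_nil psum_nil.
rewrite psum_cons ssum_nil /= b_min (multilinear0 [::] [::] hg) !addr0 subr0 g0.
have -> : flip (pull f al1) [::] = 0 by rewrite /flip pull_nil.
have -> : flip al [::] = 0 := al0.
have -> : flip g [::] = dga_one A := g0.
rewrite /flip /= tauK pull_psum // psum_cons ssum_nil pull_nil.
rewrite dga_mul0x dga_mulx0 dga_mulx1 dga_mul1x add0r addr0 => /(congr1 p).
rewrite linear0 (linB (linearP p)) (linD (linearP p)) pd add0r p_al1 p_al.
by move/eqP; rewrite subr_eq0 => /eqP.
Qed.

End Comparison.

(** * Inverses *)

Section Inverse.
Variables (k : fieldType) (H : gradedSpace k).
Implicit Types f g b : seq H -> H.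

(** Truncating [g] in [pull f g] removes exactly the cut into letters, and that cut contributes
    [g xs] because [f_1] is the identity. The equation therefore solves for [g xs]. *)
Lemma left_inverse_family f : multilinear f -> sdeg (-1) f -> (forall x, f [:: x] = x) ->
  exists g, [/\ multilinear g, sdeg (-1) g, forall x, g [:: x] = x &
    forall xs, xs != [::] -> pull f g xs = eta xs].
Proof.
move=> hf df f1; pose Psi g xs := eta xs - pull f g xs.
have [||||g [[hg dg] gE]] := @word_recursion H H 0
    (fun g => multilinear g /\ sdeg (-1) g) Psi.
- by split; [exact: multilinear_zero | exact: sdeg_zero].
- by move=> n g [hg dg]; split; [exact: multilinear_trunc | exact: sdeg_trunc].
- move=> g [hg dg]; split.
    by apply: multilinearD; [exact: multilinear_eta | exact/multilinearN/multilinear_pull].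
  by apply: sdegD; [exact: sdeg_eta | exact/sdegN/sdeg_pull].
- by move=> g hloc; split; [apply: multilinear_local | apply: sdeg_local] => n;
    have [g' [? ?] e] := hloc n; exists g'.
exists g; split=> // [x|xs xs0].
  by rewrite gE /Psi pull_psum // psum_cons ssum_nil pull_nil /trunc subr0.
have -> : pull f g xs =
    pull f (trunc 0 (size xs) g) xs + pull f (fun ws => g ws - trunc 0 (size xs) g ws) xs.
  by rewrite -pullD; apply: eq_pullr => ws; rewrite addrC subrK.
rewrite (pull_letters f (phi := fun ws => g ws - trunc 0 (size xs) g ws)) => [|ws sws].
  rewrite (eq_map f1) map_id {2}/trunc ltnn subr0 addrC.
  by rewrite gE /Psi subrK.
by rewrite /trunc sws subrr.
Qed.

(** As in a monoid: the left inverse [g] of [f] has itself a left inverse [g'], and associativity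
    forces [g' = f] on nonempty words. *)
Lemma inverse_family f : multilinear f -> sdeg (-1) f -> (forall x, f [:: x] = x) ->
  exists g, [/\ multilinear g, sdeg (-1) g,
    forall xs, xs != [::] -> pull f g xs = eta xs &
    forall xs, xs != [::] -> pull g f xs = eta xs].
Proof.
move=> hf df f1.
have [g [hg dg g1 fg]] := left_inverse_family hf df f1.
have [g' [hg' dg' _ gg']] := left_inverse_family hg dg g1.
exists g; split=> // xs xs0; rewrite -gg' //; apply: eq_pull => // ws _ /(_ xs0) ws0.
rewrite -[RHS]pull_etal // -[LHS](pull_etar f ws0).
rewrite [RHS](eq_pull (f' := pull f g) (phi' := g')) // => [|u u0 _]; last by rewrite fg.
rewrite -pull_comp //; apply: eq_pull => // us _ /(_ ws0) us0.
by rewrite gg'.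
Qed.

(** [pull f] is undone by [pull g], so the equation may be checked after [pull f], where both sides
    become [b]. *)
Lemma inverse_morphism b b1 f g : multilinear b -> multilinear b1 ->
  multilinear f -> sdeg (-1) f -> multilinear g ->
  (forall xs, xs != [::] -> pull f g xs = eta xs) ->
  (forall xs, xs != [::] -> pull g f xs = eta xs) ->
  (forall xs, xs != [::] -> ins b f xs = pull f b1 xs) ->
  forall xs, xs != [::] -> ins b1 g xs = pull g b xs.
Proof.
move=> hb hb1 hf df hg fg gf fm.
have inj X : multilinear X -> forall xs, xs != [::] -> pull g (pull f X) xs = X xs.
  move=> hX xs xs0; rewrite pull_comp // -[RHS]pull_etal //.
  by apply: eq_pull => // u u0 _; rewrite gf.
have e xs : xs != [::] -> pull f (ins b1 g) xs = pull f (pull g b) xs.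
  move=> xs0; rewrite pull_ins // pull_comp //.
  have ftau v : v != [::] -> f (map tau v) = tau (f v) by move=> _; exact: sdeg_tauN1.
  transitivity (ins b (pull f g) xs).
    rewrite ins_pull //; apply: eq_ssum => u w _; apply: eq_psum => v z _ v0.
    by rewrite fm.
  rewrite (eq_ins (b' := b) (phi' := @eta k H)) // => [|ws /andP[ws0 _]]; last first.
    by apply: fg; case: ws ws0.
  rewrite ins_eta // -[LHS]pull_etal //; apply: eq_pull => // u u0 _.
  by rewrite fg.
move=> xs xs0; rewrite -[LHS]inj //; last exact: multilinear_ins.
rewrite -[RHS]inj //; last exact: multilinear_pull.
by apply: eq_pull => // ws _ /(_ xs0) ws0; rewrite e.
Qed.

End Inverse.

(** * Passage between A-infinity data and functions on words *)

Section BarDictionary.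
Variables (k : fieldType).
Implicit Types V W : gradedSpace k.

Lemma signz_inj V (z : int) : injective (fun x : V => (-1 : k) ^ z *: x).
Proof. by apply: (can_inj (g := fun x => (-1) ^ z *: x)) => x; rewrite scalerA signz_sqr scale1r. Qed.

Lemma sdeg_structure V (m : ainfStructure V) : sdeg (-2) (bar m).
Proof. by apply: sdeg_bar; [exact: ainf_multilinear | exact: ainf_degree]. Qed.

Lemma sdeg_morphism V W (m : ainfStructure V) (m' : ainfStructure W)
  (f : ainfMorphism m m') : sdeg (-1) (bar f).
Proof. by apply: sdeg_bar; [exact: amor_multilinear | exact: amor_degree]. Qed.

Lemma bar_stasheff V (m : ainfStructure V) xs : ins (bar m) (bar m) xs = 0.
Proof.
have hm := @ainf_multilinear _ _ m; have hbm := multilinear_bar hm.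
apply: (multilinear_eq (psi := fun=> 0)).
- exact: multilinear_ins.
- exact: multilinear_zero.
move=> ys hys _; have [->|ys0] := eqVneq ys [::]; first exact: ins_nil.
apply: (@signz_inj V (bar_exp ys)); rewrite scaler0.
rewrite -insert_sumE //; last exact: ainf_degree.
by apply: ainf_stasheff => //; rewrite lt0n size_eq0.
Qed.

Lemma bar_morphism V W (m : ainfStructure V) (m' : ainfStructure W)
    (f : ainfMorphism m m') xs : xs != [::] ->
  ins (bar m) (bar f) xs = pull (bar f) (bar m') xs.
Proof.
have hm := @ainf_multilinear _ _ m; have hm' := @ainf_multilinear _ _ m'.
have hf := @amor_multilinear _ _ _ _ _ f; have df := @amor_degree _ _ _ _ _ f.
move=> xs0; apply: multilinear_eq.
- by apply: multilinear_ins; exact: multilinear_bar.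
- by apply: multilinear_pull; exact: multilinear_bar.
move=> ys hys sz; have ys0 : (0 < size ys)%N by rewrite sz lt0n size_eq0.
apply: (@signz_inj W (bar_exp ys)); rewrite -blockwise_sumE //.
rewrite -insert_sumE //; last exact: ainf_degree.
exact: amor_eq.
Qed.

(** [bar] is an involution on nonempty words, so reading [bar b] on the suspension gives [b]
    back. *)
Lemma structure_of_bar V (b : seq V -> V) : multilinear b -> sdeg (-2) b ->
  (forall xs, ins b b xs = 0) -> exists m : ainfStructure V, m = bar b :> (seq V -> V).
Proof.
move=> hb db bb; have hbb := multilinear_bar hb.
have dbb := family_degree_bar hb db.
unshelve eexists (@AinfStructure k V (bar b) hbb dbb _) => //.
move=> xs hxs xs0; rewrite insert_sumE // (eq_ins (b' := b) (phi' := b)) ?bb ?scaler0 //.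
  by move=> v v0; rewrite barK.
by move=> ws /andP[ws0 _]; rewrite barK //; case: ws ws0.
Qed.

Lemma morphism_of_bar V W (m : ainfStructure V) (m' : ainfStructure W) (f : seq V -> W) :
  multilinear f -> sdeg (-1) f ->
  (forall xs, xs != [::] -> ins (bar m) f xs = pull f (bar m') xs) ->
  exists F : ainfMorphism m m', F = bar f :> (seq V -> W).
Proof.
move=> hf df fm; have hbf := multilinear_bar hf.
have dbf := family_degree_bar hf df.
unshelve eexists (@AinfMorphism k V W m m' (bar f) hbf dbf _) => //.
move=> xs hxs xs0; have hm := @ainf_multilinear _ _ m.
have hm' := @ainf_multilinear _ _ m'.
have e0 : elts xs != [::] by case: (xs) xs0.
rewrite blockwise_sumE // insert_sumE //; last exact: ainf_degree.
congr (_ *: _); rewrite (eq_ins (b' := bar m) (phi' := f)) //; last first.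
  by move=> ws /andP[ws0 _]; rewrite barK //; case: ws ws0.
by rewrite fm //; apply: eq_pull => // u u0 _; rewrite barK.
Qed.

Lemma ainf_comp_bar V (f g F G : seq V -> V) :
  F = bar f -> G = bar g -> multilinear f -> sdeg (-1) f -> multilinear g ->
  (forall xs, xs != [::] -> pull f g xs = eta xs) ->
  same_family (ainf_comp G F) (@ainf_id k V).
Proof.
move=> -> -> hf df hg fg xs hxs xs0; rewrite /ainf_comp.
rewrite blockwise_sumE //; try exact: multilinear_bar; last exact: family_degree_bar.
have e0 : elts xs != [::] by case: (xs) xs0.
rewrite (eq_pull (f' := f) (phi' := g)) => [|u u0 _|ws _ /(_ e0) ws0]; last 2 first.
- by rewrite barK.
- by rewrite barK.
rewrite fg //; case: xs {hxs xs0 e0} => [|[i x] [|q xs]] /=; rewrite ?scaler0 //.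
by rewrite mulr0 addr0 expr0z scale1r.
Qed.

End BarDictionary.

(** * Minimal models *)

Section MinimalModels.
Variables (k : fieldType) (A : dgAlgebra k).
Local Notation C := (ainf_complex (dga_ainf A)).
Local Notation H := (homology C).

Lemma bar_twisting (V : gradedSpace k) (m : ainfStructure V)
    (i : ainfMorphism m (dga_ainf A)) xs :
  ins (bar m) (bar i) xs = cx_d (bar i xs) + cup (flip (bar i)) (bar i) xs.
Proof.
have [->|xs0] := eqVneq xs [::].
  rewrite ins_nil bar_nil (lin0 (@cx_d_linear k A)) /cup ssum_nil.
  by rewrite [flip (bar i) [::]]bar_nil dga_mul0x addr0.
rewrite bar_morphism // pull_dga_op // => v; apply: sdeg_tauN1.
  exact/multilinear_bar/amor_multilinear.
exact: sdeg_morphism.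
Qed.

(** As [m_1 = 0], every [x] is a cycle, and the condition on homology says that the cycle [i [:: x]]
    has class [x]; [p] computes classes of cycles. *)
Lemma minimal_model_section (p : C -> H)
    (m : ainfStructure H) (i : ainfMorphism m (dga_ainf A)) :
  (forall z : Defs.cycle C, p (cycle_val z) = hclass z) ->
  is_minimal_model i -> forall x : H, p (i [:: x]) = x.
Proof.
move=> pz [m1 _ _ mi] x.
have xc : @is_cycle k (ainf_complex m) x by apply/eqP; exact: m1.
have := mi (Cycle xc); rewrite homology_mapE -pz => e.
exact: e.
Qed.

Lemma minimal_model_exists :
  exists (m : ainfStructure H) (i : ainfMorphism m (dga_ainf A)), is_minimal_model i.
Proof.
have [i [p [h [[ideg pdeg hdeg] di pd pz [pi htpy]]]]] := contraction C.
have [F [b [[hF dF F0] [hb db bb] bE F1 Feq]]] := @transfer k A H i p h ideg pdeg hdeg di pd htpy.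
have [m mE] := structure_of_bar hb db bb.
have Ftau v : F (map tau v) = tau (F v) by exact: sdeg_tauN1.
have [|f fE] := @morphism_of_bar k H A m (dga_ainf A) F hF dF.
  move=> xs xs0; rewrite (pull_dga_op F0 Ftau xs0) -Feq mE.
  by apply: eq_ins => // v v0; rewrite barK.
have f1 x : f [:: x] = i x by rewrite fE; exact: F1.
have m1 x : m [:: x] = 0.
  rewrite mE /bar /= bE /cup ssum_cons ssum_nil F0 dga_mulx0 addr0.
  by rewrite [flip F [::]]F0 dga_mul0x linear0.
have hmap (z : Defs.cycle (ainf_complex m)) :
    homology_map (amor1_chain_map f) (hclass z) = cycle_val z.
  rewrite homology_mapE -pz /= -[RHS]pi; congr (p _); exact: f1.
exists m, f; split=> // [x y|].
  (* The [tau] from [flip] cancels the one from [bar], leaving [p] of the product of the cycles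
     [i x] and [i y], which is the induced product. *)
  rewrite mE /bar /= bE /cup !ssum_cons ssum_nil F0 dga_mulx0 addr0.
  rewrite [flip F [::]]F0 dga_mul0x add0r [flip F _]/= /flip /= tauK !F1.
  have cy q : @is_cycle k C (i q) by apply/eqP; exact: di.
  rewrite -{2}[x]pi -{2}[y]pi (pz (Cycle (cy x))) (pz (Cycle (cy y))) induced_mulE.
  by rewrite -pz.
have xc (q : H) : @is_cycle k (ainf_complex m) q by apply/eqP; exact: m1.
exists (fun q => hclass (Cycle (xc q))) => q; last by rewrite hmap.
rewrite -[q]hreprK hmap; congr hclass; exact: val_inj.
Qed.

Lemma minimal_model_unique (m m' : ainfStructure H)
    (i : ainfMorphism m (dga_ainf A)) (i' : ainfMorphism m' (dga_ainf A)) :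
  is_minimal_model i -> is_minimal_model i' -> ainf_isomorphic m m'.
Proof.
move=> mi mi'; have [m1 _ _ _] := mi.
have [j [p [h [[jdeg pdeg hdeg] dj pd pz [pj htpy]]]]] := contraction C.
have hbar (n : ainfStructure H) : multilinear (bar n).
  exact/multilinear_bar/ainf_multilinear.
have hbari (n : ainfStructure H) (l : ainfMorphism n (dga_ainf A)) : multilinear (bar l).
  exact/multilinear_bar/amor_multilinear.
have [f [hf df f1 fm]] := @comparison k A H j p h pdeg hdeg pd htpy
  (bar m) (bar m') (bar i) (bar i') (hbar m) (sdeg_structure m) (bar_stasheff m) m1
  (hbari _ i) (sdeg_morphism i) erefl (hbari _ i') (sdeg_morphism i') erefl
  (bar_twisting i) (bar_twisting i')
  (minimal_model_section pz mi) (minimal_model_section pz mi').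
have [g [hg dg fg gf]] := inverse_family hf df f1.
have fm' xs : xs != [::] -> ins (bar m) f xs = pull f (bar m') xs.
  by move=> xs0; rewrite fm.
have gm := inverse_morphism (hbar m) (hbar m') hf df hg fg gf fm'.
have [F FE] := morphism_of_bar hf df fm'.
have [G GE] := morphism_of_bar hg dg gm.
exists F, G; split.
  exact: (ainf_comp_bar FE GE).
exact: (ainf_comp_bar GE FE).
Qed.

End MinimalModels.

Theorem theorem6p11 (k : fieldType) (A : dgAlgebra k) :
  (exists (m : ainfStructure (homology (ainf_complex (dga_ainf A))))
          (i : ainfMorphism m (dga_ainf A)), is_minimal_model i) /\
  (forall (m m' : ainfStructure (homology (ainf_complex (dga_ainf A))))
          (i : ainfMorphism m (dga_ainf A)) (i' : ainfMorphism m' (dga_ainf A)),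
     is_minimal_model i -> is_minimal_model i' -> ainf_isomorphic m m').
Proof.
split; first exact: minimal_model_exists.
exact: minimal_model_unique.
Qed.
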